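(* Let $T\ge1$ and let $\mathcal X$ be the space of LP instances $(\mathbf c,\mathbf G,\mathbf h,\mathbf A,\mathbf b,\boldsymbol\ell,\mathbf u)$ with $n$ variables, $m_1$ inequality constraints and $m_2$ equality constraints. For $\eta,\omega>0$ define $u_{\eta,\omega}:\mathcal X\to\{0,\dots,T\}$ by $$u_{\eta,\omega}(\mathbf c,\mathbf G,\mathbf h,\mathbf A,\mathbf b,\boldsymbol\ell,\mathbf u)=\min\{t\le T:\mathtt{terminate}(\mathbf x^{(t)},\mathbf y^{(t)})=\mathtt{true}\}$$ if such a $t$ exists, and $u_{\eta,\omega}=T$ otherwise, where $\mathbf x^{(t)},\mathbf y^{(t)}$ are the PDHG iterates on the instance with step size $\eta$ and primal weight $\omega$. Then $$\operatorname{Pdim}(\{u_{\eta,\omega}:\eta,\omega>0\})=O(T\log(m_1nT)).$$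
   Context: LP instance: $\min\{\mathbf c^\top\mathbf x:\mathbf G\mathbf x\ge\mathbf h,\ \mathbf A\mathbf x=\mathbf b,\ \boldsymbol\ell\le\mathbf x\le\mathbf u\}$ with $\mathbf c\in\mathbb R^n$, $\mathbf G\in\mathbb R^{m_1\times n}$, $\mathbf h\in\mathbb R^{m_1}$, $\mathbf A\in\mathbb R^{m_2\times n}$, $\mathbf b\in\mathbb R^{m_2}$, $\boldsymbol\ell\in(\mathbb R\cup\{-\infty\})^n$, $\mathbf u\in(\mathbb R\cup\{\infty\})^n$. Put $\mathbf K^\top=[\mathbf G^\top\ \mathbf A^\top]$, $\mathbf q^\top=[\mathbf h^\top\ \mathbf b^\top]$, $X=\{\mathbf x\in\mathbb R^n:\boldsymbol\ell\le\mathbf x\le\mathbf u\}$, $Y=\{\mathbf y\in\mathbb R^{m_1+m_2}:y_1,\dots,y_{m_1}\ge 0\}$. PDHG with step size $\eta>0$ and primal weight $\omega>0$: starting from fixed initial iterates $\mathbf x^{(0)},\mathbf y^{(0)}$ not depending on $(\eta,\omega)$, $$\mathbf x^{(t+1)}=\operatorname{proj}_X\big(\mathbf x^{(t)}-\tfrac{\eta}{\omega}(\mathbf c-\mathbf K^\top\mathbf y^{(t)})\big),\qquad \mathbf y^{(t+1)}=\operatorname{proj}_Y\big(\mathbf y^{(t)}+\eta\omega(\mathbf q-\mathbf K(2\mathbf x^{(t+1)}-\mathbf x^{(t)}))\big),$$ where $\operatorname{proj}_X$ clamps each coordinate to $[\ell_i,u_i]$ and $\operatorname{proj}_Y$ replaces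 each of the first $m_1$ coordinates by its maximum with $0$. Termination. Let $\Lambda_i=\{0\}$ if $\ell_i=-\infty,u_i=\infty$; $\Lambda_i=\mathbb R_{\le0}$ if $\ell_i=-\infty,u_i\in\mathbb R$; $\Lambda_i=\mathbb R_{\ge0}$ if $\ell_i\in\mathbb R,u_i=\infty$; $\Lambda_i=\mathbb R$ if $\ell_i,u_i\in\mathbb R$. Given $(\mathbf x,\mathbf y)$ let $\boldsymbol\lambda=\operatorname{proj}_{\Lambda_1\times\cdots\times\Lambda_n}(\mathbf c-\mathbf K^\top\mathbf y)$, and let $^+,{}^-$ denote componentwise positive and negative parts ($v^+=\max(v,0)$, $v^-=\max(-v,0)$; a zero coefficient times an infinite bound is $0$). For a fixed tolerance $\varepsilon_{\mathrm{tol}}>0$, $\mathtt{terminate}(\mathbf x,\mathbf y)$ is true iff all three hold: (1) $|\mathbf q^\top\mathbf y+\boldsymbol\ell^\top\boldsymbol\lambda^+-\mathbf u^\top\boldsymbol\lambda^--\mathbf c^\top\mathbf x|\le\varepsilon_{\mathrm{tol}}(1+|\mathbf q^\top\mathbf y+\boldsymbol\ell^\top\boldsymbol\lambda^+-\mathbf u^\top\boldsymbol\lambda^-|+|\mathbf c^\top\mathbf x|)$; (2) $\big(\|\mathbf A\mathbf x-\mathbf b\|_2^2+\|(\mathbf h-\mathbf G\mathbf x)^+\|_2^2\big)^{1/2}\le\varepsilon_{\mathrm{tol}}(1+\|\mathbf q\|_2)$; (3) $\|\mathbf c-\mathbf K^\top\mathbf y-\boldsymbol\lambda\|_2\le\varepsilon_{\mathrm{tol}}(1+\|\mathbf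 c\|_2)$. Pseudo-dimension: for a class $\mathcal U=\{u_\phi:\mathcal X\to\mathbb R\mid\phi\in\Phi\}$, $\operatorname{Pdim}(\mathcal U)$ is the largest integer $N$ for which there exist $x_1,\dots,x_N\in\mathcal X$ and thresholds $\gamma_1,\dots,\gamma_N\in\mathbb R$ such that for every $\sigma\in\{-1,1\}^N$ there is $\phi\in\Phi$ with $\operatorname{sign}(u_\phi(x_i)-\gamma_i)=\sigma_i$ for all $i$. The constant in $O(\cdot)$ is absolute. *)

(* Defs.v *)
From HB Require Import structures.
From mathcomp Require Import all_boot all_order all_algebra.
From mathcomp Require Import all_classical all_reals all_analysis.
Set Implicit Arguments.
Unset Strict Implicit.
Unset Printing Implicit Defensive.
Import Order.TTheory GRing.Theory Num.Theory.
Local Open Scope classical_set_scope.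
Local Open Scope ring_scope.

Section PseudoDimension.
Context {R : realType} {X : Type}.
Implicit Type U : set (X -> R).

(* [s : 'I_N -> bool] encodes a sign vector, [(-1) ^+ s i] being its entries. *)
Definition pseudo_shattered U N (x : 'I_N -> X) (g : 'I_N -> R) : Prop :=
  forall s : 'I_N -> bool,
    exists2 f, U f & forall i, Num.sg (f (x i) - g i) = (-1) ^+ s i.

(* The supremum is the largest shattered size if there is one, else +oo. *)
Definition Pdim U : \bar R :=
  ereal_sup [set N%:R%:E | N in
    [set N : nat | exists x g, @pseudo_shattered U N x g]].

End PseudoDimension.

Section Vectors.
Context {R : realType}.

Definition dotv n (v w : 'cV[R]_n) : R := (v^T *m w) 0 0.

(* The library's norm on matrices is the max-norm. *)
Definition norm2 n (v : 'cV[R]_n) : R := Num.sqrt (\sum_i v i 0 ^+ 2).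

Definition pos_part (r : R) : R := Num.max r 0.
Definition neg_part (r : R) : R := Num.max (- r) 0.

Definition nearest n (S : set 'cV[R]_n) (v : 'cV[R]_n) : set 'cV[R]_n :=
  [set w | S w /\ forall w', S w' -> norm2 (v - w) <= norm2 (v - w')].

(* Euclidean projection; the default value [v] is irrelevant when [S] is
   nonempty, closed and convex. *)
Definition euclid_proj n (S : set 'cV[R]_n) (v : 'cV[R]_n) : 'cV[R]_n :=
  xget v (nearest S v).

End Vectors.

Record lp (R : realType) (n m1 m2 : nat) := LP {
  lp_c : 'cV[R]_n;
  lp_G : 'M[R]_(m1, n);
  lp_h : 'cV[R]_m1;
  lp_A : 'M[R]_(m2, n);
  lp_b : 'cV[R]_m2;
  lp_l : 'cV[\bar R]_n;
  lp_u : 'cV[\bar R]_n;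
  lp_l_lty : forall i, (lp_l i 0%R < +oo)%E;
  lp_u_gtNy : forall i, (-oo < lp_u i 0%R)%E }.

Section PDHG.
Context {R : realType} {n m1 m2 : nat}.
Variable I : lp R n m1 m2.

Local Notation c := (lp_c I).
Local Notation G := (lp_G I).
Local Notation h := (lp_h I).
Local Notation A := (lp_A I).
Local Notation b := (lp_b I).
Local Notation l := (lp_l I).
Local Notation u := (lp_u I).

Definition lp_K : 'M[R]_(m1 + m2, n) := col_mx G A.
Definition lp_q : 'cV[R]_(m1 + m2) := col_mx h b.

(* The clamped value is finite because [l i 0 < +oo] and [-oo < u i 0]. *)
Definition projX (x : 'cV[R]_n) : 'cV[R]_n :=
  \col_i fine (Order.min (Order.max (x i 0)%:E (l i 0)) (u i 0)).

Definition projY (y : 'cV[R]_(m1 + m2)) : 'cV[R]_(m1 + m2) :=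
  col_mx (map_mx (fun r => Num.max r 0) (usubmx y)) (dsubmx y).

Definition pdhg_step (eta omega : R)
    (z : 'cV[R]_n * 'cV[R]_(m1 + m2)) : 'cV[R]_n * 'cV[R]_(m1 + m2) :=
  let: (x, y) := z in
  let x' := projX (x - (eta / omega) *: (c - lp_K^T *m y)) in
  let y' := projY (y + (eta * omega) *: (lp_q - lp_K *m (2 *: x' - x))) in
  (x', y').

Definition pdhg (eta omega : R) (z0 : 'cV[R]_n * 'cV[R]_(m1 + m2)) (t : nat) :=
  iter t (pdhg_step eta omega) z0.

Definition Lambda (i : 'I_n) : set R :=
  match l i 0, u i 0 with
  | -oo%E, +oo%E => [set 0]
  | -oo%E, _ => [set r | r <= 0]
  | _, +oo%E => [set r | 0 <= r]
  | _, _ => setT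
  end.

Definition dual_slack (y : 'cV[R]_(m1 + m2)) : 'cV[R]_n :=
  euclid_proj [set w | forall i, Lambda i (w i 0)] (c - lp_K^T *m y).

(* q^T y + l^T lambda^+ - u^T lambda^-. In [\bar R] a product of zero and an
   infinity is zero, and [Lambda] forces the coefficient of any infinite bound
   to vanish, so that [fine] is only applied to finite values. *)
Definition dual_obj (y : 'cV[R]_(m1 + m2)) : R :=
  let lam := dual_slack y in
  dotv lp_q y
  + \sum_i fine (l i 0%R * (pos_part (lam i 0%R))%:E)%E
  - \sum_i fine (u i 0%R * (neg_part (lam i 0%R))%:E)%E.

Definition terminate (tol : R) (z : 'cV[R]_n * 'cV[R]_(m1 + m2)) : bool :=
  let: (x, y) := z in
  [&& `|dual_obj y - dotv c x| <= tol * (1 + `|dual_obj y| + `|dotv c x|),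
      Num.sqrt (norm2 (A *m x - b) ^+ 2
                + norm2 (map_mx pos_part (h - G *m x)) ^+ 2)
        <= tol * (1 + norm2 lp_q)
    & norm2 (c - lp_K^T *m y - dual_slack y) <= tol * (1 + norm2 c)].

(* All indices range over [0, T], so [T] is also a neutral element for the
   minimum, and is the value when no iterate terminates. *)
Definition pdhg_steps (T : nat) (tol : R)
    (z0 : 'cV[R]_n * 'cV[R]_(m1 + m2)) (eta omega : R) : nat :=
  \big[minn/T]_(t < T.+1 | terminate tol (pdhg eta omega z0 t)) t.

End PDHG.

(* The initial iterates may depend on the instance, not on the parameters. *)
Definition pdhg_class (R : realType) (n m1 m2 T : nat) (tol : R)
    (z0 : lp R n m1 m2 -> 'cV[R]_n * 'cV[R]_(m1 + m2)) :
    set (lp R n m1 m2 -> R) :=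
  [set f | exists eta omega : R, [/\ 0 < eta, 0 < omega &
    f = fun I => (pdhg_steps I T tol (z0 I) eta omega)%:R]].

(* Main.v *)
Require Import Defs.
From HB Require Import structures.
From mathcomp Require Import all_boot all_order all_algebra.
From mathcomp Require Import all_field polyrcf.
From mathcomp Require Import all_classical all_reals all_analysis.
From mathcomp Require Import ring lra zify.
Import Order.TTheory GRing.Theory Num.Theory.
Import numFieldNormedType.Exports.
Local Open Scope classical_set_scope.
Local Open Scope ring_scope.
Set Implicit Arguments.
Unset Strict Implicit.
Unset Printing Implicit Defensive.

(** In the parameters [alpha = eta / omega] and [beta = eta * omega] one step of
    the algorithm is made of polynomial operations and of comparisons of
    polynomials with zero: the clamps, and the tests of the stopping rule.
    Hence, as long as all comparisons made so far have the same outcome, the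
    iterates are polynomials in [(alpha, beta)], and their degree grows
    linearly in the number of steps.

    Suppose that [N] instances are shattered. A round of the algorithm on all of
    them makes its comparisons in four batches, each of [O(N * (n + m1 + 1))]
    polynomials of degree [O(T)] that depend only on the outcomes of the batches
    before (the number [m2] of equality constraints does not occur, since these
    cause no comparison). As [s] polynomials of degree at most [d] in two real
    variables realize at most [2 * (s * (d + 2) + 1) ^ 3] patterns of outcomes
    ([few_sign_patterns]), each batch multiplies the number of possible
    behaviours by [(O(N * (n + m1 + 1) * T)) ^ 3] at most ([piecewise_step],
    [piecewise_round]). After [T] rounds this leaves
    [(O(N * (n + m1 + 1) * T)) ^ O(T)] behaviours. The behaviour decides on which
    instances the number of steps is below its threshold, and all [2 ^ N]
    answers occur, so that [2 ^ N <= (O(N * (n + m1 + 1) * T)) ^ O(T)]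
    ([shattered_exp_le]), whence [N = O(T * log (m1 * n * T))]
    ([le_of_exp_le]). When [T = 1] the number of steps does not depend on the
    parameters, and nothing is shattered.

    The bound on sign patterns is proved by sweeping the plane with vertical
    lines. A small perturbation turns the given polynomials into ones whose
    product [Q] is monic in the first variable [y], has a discriminant that is
    not identically zero, and vanishes at none of finitely many chosen points,
    one for each pattern. Over a point [x] where the discriminant does not
    vanish the roots of [Q] are simple, so every pattern seen off the curve
    [Q = 0] on a line near [x] is also seen on the line through [x]
    ([slices_near]). So the set of patterns on a vertical line is constant on
    each interval between roots of the discriminant, whose number is bounded by
    the degree of the discriminant, and on a single line the number of patterns
    exceeds the degree of [Q] by one at most. *)

(** * Maps with few values *)

(** On [D] the map [F] takes at most [M] values. A numbering of the values is
    used because codomains are often types of functions, without decidable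
    equality. *)
Definition few {Z A : Type} (D : set Z) (F : Z -> A) (M : nat) : Prop :=
  exists g : Z -> nat,
    (forall z, D z -> (g z < M)%N) /\
    (forall z z', D z -> D z' -> g z = g z' -> F z = F z').

Lemma few_le (Z A : Type) (D : set Z) (F : Z -> A) (M M' : nat) :
  (M <= M')%N -> few D F M -> few D F M'.
Proof.
by move=> le_MM' [g [gM gF]]; exists g; split=> // z /gM /leq_trans; apply.
Qed.

Lemma few_sub (Z A : Type) (D D' : set Z) (F : Z -> A) (M : nat) :
  D' `<=` D -> few D F M -> few D' F M.
Proof.
move=> sD [g [gM gF]]; exists g.
by split=> [z /sD/gM //|z z' /sD + /sD]; exact: gF.
Qed.

Lemma few_comp (Z A B : Type) (D : set Z) (F : Z -> A) (h : A -> B) (M : nat) :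
  few D F M -> few D (fun z => h (F z)) M.
Proof.
by move=> [g [gM gF]]; exists g; split=> // z z' Dz Dz' /(gF _ _ Dz Dz') ->.
Qed.

Lemma few_set (Z : Type) (T : finType) (D : set Z) (F : Z -> T) (S : {set T}) :
  (forall z, D z -> F z \in S) -> few D F #|S|.
Proof.
move=> FS; exists (fun z => index (F z) (enum S)); split.
  by move=> z Dz; rewrite cardE index_mem mem_enum FS.
by move=> z z' Dz Dz'; apply: (index_inj (F z)); rewrite mem_enum FS.
Qed.

Lemma few_card (Z : Type) (T : finType) (D : set Z) (F : Z -> T) (S : {set T})
    (M : nat) :
  few D F M -> (forall t, t \in S -> exists2 z, D z & F z = t) -> (#|S| <= M)%N.
Proof.
move=> [g [gM gF]] /= SF.
have /choice [w wP] : forall t : T, exists k : nat,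
    t \in S -> exists2 z, D z & F z = t /\ g z = k.
  move=> t; have [/SF[z Dz Fz]|/negP nS] := boolP (t \in S).
    by exists (g z) => _; exists z.
  by exists 0%N.
have wM t : t \in S -> (w t < M)%N by move=> /wP[z /gM + [_ <-]].
case: M wM {gM} => [wM|M wM].
  by rewrite leqn0 cards_eq0; apply/eqP/setP => t; rewrite inE; apply/negP => /wM.
rewrite -(card_ord M.+1) -(card_in_imset (f := fun t => inord (w t) : 'I_M.+1)).
  exact: max_card.
move=> t t' tS tS' /(congr1 val) /=; rewrite !inordK ?wM// => eq_w.
have [z Dz [Fz gz]] := wP t tS; have [z' Dz' [Fz' gz']] := wP t' tS'.
by rewrite -Fz -Fz'; apply: gF => //; rewrite gz gz' eq_w.
Qed.

(** The rule behind every count of behaviours below: if [F] has few values, it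
    is enough to count those of [G] on each fibre of [F], where the description
    of [G] may depend on the value of [F]. *)
Lemma few_pair (Z A B : Type) (D : set Z) (F : Z -> A) (G : Z -> B)
    (M M' : nat) :
  few D F M ->
  (forall z0, D z0 -> few (D `&` [set z | F z = F z0]) G M') ->
  few D (fun z => (F z, G z)) (M * M')%N.
Proof.
move=> [g [gM gF]] GM.
have /choice [g2 g2P] : forall k : nat, exists g2 : Z -> nat,
    forall z0, D z0 -> g z0 = k ->
    (forall z, D z -> F z = F z0 -> (g2 z < M')%N) /\
    (forall z z', D z -> F z = F z0 -> D z' -> F z' = F z0 ->
       g2 z = g2 z' -> G z = G z').
  move=> k; have [[z0 [Dz0 gz0]]|nk] := pselect (exists z0, D z0 /\ g z0 = k).
    have [g2 [g2M g2G]] := GM z0 Dz0; exists g2 => z1 Dz1 gz1.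
    have -> : F z1 = F z0 by apply: gF => //; rewrite gz1 gz0.
    split=> [z Dz Fz|z z' Dz Fz Dz' Fz']; first by apply: g2M.
    by apply: g2G.
  by exists (fun=> 0%N) => z0 Dz0 gz0; exfalso; apply: nk; exists z0.
exists (fun z => (g z * M' + g2 (g z) z)%N); split=> [z Dz|z z' Dz Dz' eqg].
  have [/(_ z Dz erefl) lt2 _] := g2P (g z) z Dz erefl.
  by have := gM z Dz; nia.
have [/(_ z Dz erefl) lt2 inj2] := g2P (g z) z Dz erefl.
have [/(_ z' Dz' erefl) lt2' _] := g2P (g z') z' Dz' erefl.
have M'_gt0 : (0 < M')%N by apply: leq_ltn_trans lt2.
have egz : g z = g z'.
  have := congr1 (divn^~ M') eqg.
  by rewrite !divnMDl// !divn_small// !addn0.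
have eF : F z' = F z by apply: gF.
congr pair; first exact: gF.
by apply: inj2 => //; move: eqg; rewrite -egz => /addnI.
Qed.

(** * The real line cut at finitely many points *)

Section OneVariable.
Context {R : realType}.

(** The values are numbered by the intervals between points of [rs], that is by
    the number of elements of [rs] below the argument. *)
Lemma few_off_seq (A : Type) (rs : seq R) (f : R -> A) :
  (forall a b, a <= b -> (forall c, a <= c <= b -> c \notin rs) -> f a = f b) ->
  few [set x | x \notin rs] f (size rs).+1.
Proof.
move=> fP; exists (fun x => count (fun c => (c < x)%R) rs); split.
  by move=> x _; rewrite ltnS count_size.
suff main x x' : x <= x' -> x \notin rs -> x' \notin rs ->
    count (fun c => (c < x)%R) rs = count (fun c => (c < x')%R) rs -> f x = f x'.
  move=> x x' /= xr xr' eqc; have [le|/ltW le] := leP x x'; first exact: main.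
  by apply/esym/main.
move=> le xr xr' eqc; apply: fP => // c /andP[le1 le2]; apply/negP => crs.
have lt1 : x < c by rewrite lt_neqAle le1 andbT; apply: contraNneq xr => ->.
have lt2 : c < x' by rewrite lt_neqAle le2 andbT; apply: contraNneq xr' => <-.
have : (count (fun c => (c < x)%R) rs < count (fun c => (c < x')%R) rs)%N;
  last by rewrite eqc ltnn.
have -> : count (fun c => (c < x')%R) rs =
    (count (fun c => (c < x)%R) rs + count (fun c => (x <= c < x')%R) rs)%N.
  elim: (rs) => //= d s ->; case: (ltP d x) => /= dx.
    by rewrite (lt_le_trans dx le) /=; lia.
  by case: (d < x') => /=; lia.
rewrite -[X in (X < _)%N]addn0 ltn_add2l -has_count; apply/hasP; exists c => //.
by rewrite le1 lt2.
Qed.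

Lemma avoid_seq (rs : seq R) (a b : R) : a < b ->
  exists2 c, a < c < b & c \notin rs.
Proof.
elim: rs a b => [|r rs IH] a b ab.
  by exists ((a + b) / 2) => //; rewrite midf_lt//=; lra.
have [/andP[ar rb]|nin] := boolP (a < r < b).
  have [c /andP[rc cb] crs] := IH _ _ rb.
  exists c; first by rewrite cb (lt_trans ar).
  by rewrite inE negb_or crs andbT gt_eqF.
have [c cab crs] := IH _ _ ab; exists c => //.
by rewrite inE negb_or crs andbT; apply: contraNneq nin => <-.
Qed.

Lemma same_sign_of_noroot (p : {poly R}) (a b : R) : a <= b ->
  (forall c, a <= c <= b -> p.[c] != 0) -> (0 <= p.[a]) = (0 <= p.[b]).
Proof.
move=> ab nr; have [//|ne] := eqVneq (0 <= p.[a]) (0 <= p.[b]).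
have [|c] := @polyrcf.poly_ivt _ p a b ab.
  move: ne; case: (leP 0 p.[a]); case: (leP 0 p.[b]) => // hb ha _.
    by rewrite mulr_ge0_le0// ltW.
  by rewrite mulr_le0_ge0// ltW.
by rewrite in_itv /= => /nr /negbTE; rewrite rootE => ->.
Qed.

Lemma locally_constant_segment (A : Type) (f : R -> A) (a b : R) : a <= b ->
  (forall c, a <= c <= b -> \forall x \near c, f x = f c) -> f a = f b.
Proof.
move=> ab fl.
pose B := `[a, b]%classic `&` [set x | f x = f a].
have aI : `[a, b]%classic a by rewrite /= in_itv /= lexx ab.
have bI : `[a, b]%classic b by rewrite /= in_itv /= lexx ab.
suff : B = `[a, b]%classic by move=> eB; move: bI; rewrite -eB => -[].
apply: (@segment_connected R a b); first by exists a.
- exists [set x | f x = f a]°; first exact: open_interior.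
  rewrite /B; apply/seteqP; split=> x [xI fx]; split=> //=.
    by apply: filterS (fl x xI) => y /= ->.
  exact: interior_subset fx.
- exists (~` [set x | f x <> f a]°).
    by apply: open_closedC; exact: open_interior.
  rewrite /B; apply/seteqP; split=> x [xI fx]; split=> //=.
    by move=> /interior_subset /=; rewrite fx.
  apply: contrapT => nfx; apply: fx; rewrite /interior /=.
  by apply: filterS (fl x xI) => y /= ->.
Qed.

End OneVariable.

(** * Colourings that are constant off a plane curve *)

Section PlaneCurve.
Context {R : realType}.
Implicit Types (Q : {poly {poly R}}) (x y : R).

(** [Q.[y, x]] is the value at the point with abscissa [x] and ordinate [y]: the
    outer variable of [Q] is the vertical one, and [slice Q x] is the
    restriction of [Q] to the vertical line through [x]. *)
Definition slice Q x : {poly R} := map_poly (horner_eval x) Q.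

Lemma horner_slice Q x y : (slice Q x).[y] = Q.[y, x].
Proof. by rewrite /slice -horner_swapXY horner2_swapXY. Qed.

Lemma deriv_slice Q x : (slice Q x)^`() = slice Q^`() x.
Proof. by rewrite /slice deriv_map. Qed.

Lemma monic_slice Q x : Q \is monic -> slice Q x \is monic.
Proof. exact: monic_map. Qed.

Lemma size_slice Q x : Q \is monic -> size (slice Q x) = size Q.
Proof.
move=> Qm; rewrite /slice size_map_poly_id0//.
by rewrite (monicP Qm) /horner_eval hornerC oner_neq0.
Qed.

Lemma continuous_horner2 Q : continuous (fun z : R * R => Q.[z.1, z.2]).
Proof.
elim/poly_ind: Q => [|Q p IH] z.
  rewrite (_ : (fun z => _) = cst 0); first exact: cst_continuous.
  by apply/funext => w; rewrite !horner0.
rewrite (_ : (fun w : R * R => _) = fun w => Q.[w.1, w.2] * w.1 + p.[w.2]);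
  last first.
  by apply/funext => w; rewrite hornerMXaddC hornerD hornerM hornerC.
apply: cvgD; first by apply: cvgM; [exact: IH|exact: cvg_fst].
by apply: (cvg_comp _ _ cvg_snd); exact: continuous_horner.
Qed.

Lemma box_neq0 Q y0 x0 : Q.[y0, x0] != 0 ->
  exists2 r, 0 < r &
    forall y x, `|y - y0| < r -> `|x - x0| < r -> Q.[y, x] != 0.
Proof.
move=> Q0; have := @continuous_horner2 Q (y0, x0).
have /= : \forall u \near Q.[y0, x0], u != 0.
  by apply: open_nbhs_nbhs; split=> //; exact: open_neq.
move=> /[swap] /[apply] /nbhs_ballP[r /= r0 rP]; exists r => // y x yr xr.
by apply: (rP (y, x)); split; rewrite /ball /= distrC.
Qed.

(** The colouring [h] keeps its value along horizontal and vertical segments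
    that do not meet the curve [Q = 0]. *)
Section Colouring.
Context (A : Type) (h : R -> R -> A) (Q : {poly {poly R}}).
Context (hV : forall a b x, a <= b ->
  (forall c, a <= c <= b -> Q.[c, x] != 0) -> h a x = h b x).
Context (hH : forall a b y, a <= b ->
  (forall c, a <= c <= b -> Q.[y, c] != 0) -> h y a = h y b).

Lemma colour_move_x y x x0 r : `|x - x0| < r ->
  (forall x', `|x' - x0| < r -> Q.[y, x'] != 0) -> h y x = h y x0.
Proof.
move=> xr Qn; have r0 : 0 < r by exact: le_lt_trans xr.
have [le|/ltW le] := leP x x0; [|apply/esym]; apply: hH => // c /andP[c1 c2];
  apply: Qn; apply: le_lt_trans xr.
  by rewrite ler0_norm ?subr_le0// ler0_norm ?subr_le0// lerN2 lerD2r.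
by rewrite ger0_norm ?subr_ge0// ger0_norm ?subr_ge0// lerD2r.
Qed.

Definition seen_on_slice x0 y x :=
  Q.[y, x] != 0 -> exists2 y', Q.[y', x0] != 0 & h y x = h y' x0.

(** Off the curve a horizontal move reaches the line through [x0]. At a simple
    root of the slice the derivative has no zero in a small box, so on each
    vertical line the curve meets the box at most once: moving vertically, away
    from the curve, reaches the top or the bottom of the box, which the curve
    avoids, and from there one moves horizontally. *)
Lemma seen_near_point x0 y0 :
  (Q.[y0, x0] = 0 -> Q^`().[y0, x0] != 0) ->
  exists2 r, 0 < r &
    forall y x, `|y - y0| < r -> `|x - x0| < r -> seen_on_slice x0 y x.
Proof.
move=> simple; have [Q0|Qn0] := eqVneq Q.[y0, x0] 0; last first.
  have [r r0 rP] := box_neq0 Qn0; exists r => // y x yr xr _.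
  exists y; first by apply: rP => //; rewrite subrr normr0.
  by apply: (colour_move_x xr) => x' x'r; exact: rP.
have [r r0 rP] := box_neq0 (simple Q0).
(* By Rolle's theorem, as the derivative has no zero in this box. *)
have one_root x a b : `|x - x0| < r -> y0 - r < a -> b < y0 + r -> a < b ->
    Q.[a, x] = 0 -> Q.[b, x] = 0 -> False.
  move=> xr ar br ab Qa Qb.
  have [||c] := @poly_rolle _ a b (slice Q x) => //.
    by rewrite !horner_slice Qa Qb.
  rewrite in_itv /= => /andP[ac cb]; rewrite deriv_slice horner_slice => /eqP.
  by apply/negP/rP => //; rewrite ltr_distl; apply/andP; split; lra.
have [up Eup] : exists up, up = y0 + r / 2 by eexists.
have [dn Edn] : exists dn, dn = y0 - r / 2 by eexists.
have x0r : `|x0 - x0| < r by rewrite subrr normr0.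
have Qup : Q.[up, x0] != 0.
  by apply/eqP => Qu; apply: (one_root x0 y0 up) => //; lra.
have Qdn : Q.[dn, x0] != 0.
  by apply/eqP => Qd; apply: (one_root x0 dn y0) => //; lra.
have [r1 r10 r1P] := box_neq0 Qup; have [r2 r20 r2P] := box_neq0 Qdn.
exists (Num.min (r / 2) (Num.min r1 r2)).
  by rewrite !lt_min r10 r20 divr_gt0.
move=> y x; rewrite !lt_min !ltr_distl => /and3P[/andP[y1 y2] _ _].
move=> /and3P[/andP[x1 x2] xr1 xr2] Qyx.
have xr : `|x - x0| < r by rewrite ltr_distl; apply/andP; split; lra.
have [upP|/existsNP[c1 /not_implyP[/andP[c11 c12] /negP]]] :=
    pselect (forall c, y <= c <= up -> Q.[c, x] != 0).
  exists up => //; rewrite (hV (b := up)) //; last lra.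
  apply: (@colour_move_x up x x0 r1); first by rewrite ltr_distl.
  by move=> x' x'r; apply: r1P => //; rewrite subrr normr0.
have [dnP _|/existsNP[c2 /not_implyP[/andP[c21 c22] /negP]]] :=
    pselect (forall c, dn <= c <= y -> Q.[c, x] != 0).
  exists dn => //; rewrite -(hV (a := dn)) //; last lra.
  apply: (@colour_move_x dn x x0 r2); first by rewrite ltr_distl.
  by move=> x' x'r; apply: r2P => //; rewrite subrr normr0.
rewrite !negbK => /eqP Qc2 /eqP Qc1.
have ylt : y < c1.
  by rewrite lt_neqAle c11 andbT; apply: contraNneq Qyx => ->; rewrite Qc1.
by case: (one_root x c2 c1) => //; lra.
Qed.

Context (Qmonic : Q \is monic).

(** The Cauchy bound of a monic slice is a continuous function of its
    coefficients. *)
Lemma slice_roots_bounded x0 :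
  exists2 M, 0 < M &
    \forall x \near x0, forall y, M <= `|y| -> Q.[y, x] != 0.
Proof.
pose M := cauchy_bound (slice Q x0) + 1.
have M0 : 0 < M by rewrite addr_gt0 ?cauchy_bound_gt0.
exists M => //.
have cc : {for x0, continuous (fun x => cauchy_bound (slice Q x))}.
  rewrite (_ : (fun x => _) =
      fun x => 1 + 1^-1 * \sum_(i < size Q) `|(Q`_i).[x]|); last first.
    apply/funext => x; rewrite /cauchy_bound (monicP (monic_slice x Qmonic)).
    rewrite normr1 size_slice//; congr (1 + _ * _); apply: eq_bigr => i _.
    by rewrite coef_map.
  apply: cvgD; first exact: cvg_cst.
  apply: cvgM; first exact: cvg_cst.
  have cs : continuous (fun x => \sum_(i < size Q) `|(Q`_i).[x]|).
    apply: (continuous_big add_continuous) => i _ z.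
    by apply: cvg_norm; exact: continuous_horner.
  exact: cs.
have : \forall x \near x0, cauchy_bound (slice Q x) < M.
  by apply: (cc [set r | r < M]); apply: lt_nbhsl; rewrite /M ltrDl.
apply: filterS => x xM y My; apply/eqP; rewrite -horner_slice.
move=> /(cauchy_boundP (monic_neq0 (monic_slice x Qmonic))) /lt_trans /(_ xM).
by rewrite ltNge My.
Qed.

(** For bounded [y] this follows from [seen_near_point] by compactness; a point
    far away from the horizontal axis can be moved horizontally, as there are no
    roots there. *)
Lemma slices_near x0 :
  (forall y, Q.[y, x0] = 0 -> Q^`().[y, x0] != 0) ->
  \forall x \near x0, forall y, seen_on_slice x0 y x.
Proof.
move=> simple; have [M M0 MP] := slice_roots_bounded x0.
have cpt : near_covering `[- M, M]%classic.
  by apply/compact_near_coveringP; exact: segment_compact.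
have small : \forall x \near x0,
    `[- M, M]%classic `<=` [set y | seen_on_slice x0 y x].
  apply: (cpt R (nbhs x0) (fun x y => seen_on_slice x0 y x)) => y _.
  have [r r0 rP] := seen_near_point (simple y).
  exists (ball y r, ball x0 r); first by split; exact: nbhsx_ballx.
  by move=> [y' x'] [/= yy' xx']; apply: rP; rewrite distrC.
move: MP => /nbhs_ballP[r /= r0 rP].
near=> x => y; have [yM|yM] := leP `|y| M.
  by apply: (near small x) => //=; rewrite in_itv/= -ler_norml.
have Qy x' : `|x' - x0| < r -> Q.[y, x'] != 0.
  by move=> x'r; apply: rP; [rewrite /ball/= distrC|exact: ltW].
move=> _; exists y; first by apply: Qy; rewrite subrr normr0.
apply: (@colour_move_x y x x0 r); last exact: Qy.
by near: x; exists r => //= x; rewrite distrC.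
Unshelve. all: by end_near. Qed.

End Colouring.
End PlaneCurve.

(** * Counting the colours by a vertical sweep *)

Section CountColours.
Context {R : realType}.

Lemma roots_seq (p : {poly R}) : p != 0 ->
  exists2 rs : seq R, (size rs < size p)%N &
    forall x, (x \in rs) = (p.[x] == 0).
Proof.
move=> p0; exists (rootsR p) => [|x]; last first.
  by rewrite -(roots_on_rootsR p0) in_itv /= rootE.
apply: max_poly_roots => //; last exact: uniq_roots.
by apply/allP => x; rewrite -(roots_on_rootsR p0) => /andP[].
Qed.

Context (T : finType) (h : R -> R -> T) (Q : {poly {poly R}}) (disc : {poly R}).
Context (hV : forall a b x, a <= b ->
  (forall c, a <= c <= b -> Q.[c, x] != 0) -> h a x = h b x).
Context (hH : forall a b y, a <= b ->
  (forall c, a <= c <= b -> Q.[y, c] != 0) -> h y a = h y b).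
Context (Qmonic : Q \is monic) (disc0 : disc != 0).
Context (simple : forall y x,
  disc.[x] != 0 -> Q.[y, x] = 0 -> Q^`().[y, x] != 0).

Definition colours (x : R) : {set T} :=
  finset (fun t => `[< exists2 y, Q.[y, x] != 0 & h y x = t >]).

Lemma coloursP x t :
  reflect (exists2 y, Q.[y, x] != 0 & h y x = t) (t \in colours x).
Proof. by rewrite inE; exact: asboolP. Qed.

(** Colours do not disappear from the line through [x0] when it is moved a
    little, because they are visible on open sets; by [slices_near] no new ones
    appear. *)
Lemma colours_locally_constant x0 : disc.[x0] != 0 ->
  \forall x \near x0, colours x = colours x0.
Proof.
move=> dx0; have sub := slices_near hV hH Qmonic (fun y => @simple y x0 dx0).
have sup1 t : \forall x \near x0, t \in colours x0 -> t \in colours x.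
  have [/coloursP[y Qy hy]|_] := boolP (t \in colours x0);
    last by apply: filterE => x.
  have [r r0 rP] := box_neq0 Qy.
  have yr : `|y - y| < r by rewrite subrr normr0.
  exists r => //= x; rewrite /ball_ /= distrC => xr _; apply/coloursP.
  exists y; first exact: rP.
  by rewrite -hy; apply: (colour_move_x hH xr) => x'; exact: rP.
have sup := filter_forall (nbhs_filter x0) sup1.
near=> x; apply/setP => t; apply/idP/idP; last exact: (near sup x).
move=> /coloursP[y Qy <-]; apply/coloursP.
have xs : forall y, seen_on_slice h Q x0 y x by near: x.
have [y' Qy' hy'] := xs y Qy.
by exists y'.
Unshelve. all: by end_near. Qed.

Lemma few_slices : few [set x | disc.[x] != 0] colours (size disc).
Proof.
have [rs rs_size rsP] := roots_seq disc0.
apply: (few_le rs_size); apply: (few_sub (D := [set x | x \notin rs])).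
  by move=> x /=; rewrite rsP.
apply: few_off_seq => a b ab abP; apply: locally_constant_segment => // c cab.
by apply: colours_locally_constant; rewrite -rsP abP.
Qed.

Lemma card_colours x : (#|colours x| <= size Q)%N.
Proof.
have [rs] := roots_seq (monic_neq0 (monic_slice x Qmonic)).
rewrite size_slice// => rs_size rsP.
have fw : few [set y | y \notin rs] (h ^~ x) (size Q).
  apply: (few_le rs_size); apply: few_off_seq => a b ab abP.
  by apply: hV => // c /abP; rewrite rsP horner_slice.
apply: (few_card fw) => t /coloursP[y Qy hy]; exists y => //=.
by rewrite rsP horner_slice.
Qed.

Lemma few_colours :
  few [set z : R * R | Q.[z.1, z.2] != 0 /\ disc.[z.2] != 0]
    (fun z => h z.1 z.2) (size disc * size Q).
Proof.
set D := [set z | _]; have fc : few D (fun z => colours z.2) (size disc).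
  have [g [gM gP]] := few_slices.
  exists (fun z => g z.2); split=> [z [_ /gM//]|z z' [_ d] [_ d']]; exact: gP.
have : few D (fun z => (colours z.2, h z.1 z.2)) (size disc * size Q).
  apply: few_pair fc _ => z0 _.
  apply: few_le (card_colours z0.2) _; apply: few_set => z [[Qz _] /= <-].
  by apply/coloursP; exists z.1.
exact: (few_comp snd).
Qed.

End CountColours.

(** * Discriminants of monic bivariate polynomials *)

Lemma size_prod_le (A : comNzRingType) (I : finType) (F : I -> {poly A})
    (e : I -> nat) :
  (forall i, size (F i) <= (e i).+1)%N ->
  (size (\prod_i F i)%R <= (\sum_i e i).+1)%N.
Proof.
move=> Fe.
apply: (big_ind2 (fun (p : {poly A}) k => size p <= k.+1)%N)
  => [|p m q k pm qk|i _].
- by rewrite size_poly1.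
- apply: leq_trans (size_polyMleq _ _) _; move: pm qk.
  by move: (size p) (size q) => a b; lia.
- exact: Fe.
Qed.

Lemma size_det_le (A : comNzRingType) (n e : nat) (M : 'M[{poly A}]_n) :
  (forall i j, size (M i j) <= e.+1)%N -> (size (\det M) <= (n * e).+1)%N.
Proof.
move=> Me; apply: leq_trans (size_sum _ _ _) _; apply/bigmax_leqP => s _.
rewrite size_Msign; apply: leq_trans (size_prod_le (e := fun=> e) _) _ => //.
by rewrite sum_nat_const card_ord.
Qed.

Section Discriminant.
Context {R : realType}.
Implicit Types (Q : {poly {poly R}}).

Lemma size_resultant_le Q Q' (e : nat) :
  (sizeY Q <= e.+1)%N -> (sizeY Q' <= e.+1)%N ->
  (size (resultant Q Q') <= (((size Q').-1 + (size Q).-1) * e).+1)%N.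
Proof.
move=> Qe Qe'; apply: size_det_le => i j; rewrite Sylvester_mxE.
by case: (fintype.split i) => k; rewrite mulrb; case: ifP => _;
  rewrite ?size_poly0//; apply: leq_trans (max_size_coefXY _ _) _.
Qed.

Lemma lead_coef_deriv_monic Q : Q \is monic -> (1 < size Q)%N ->
  lead_coef Q^`() = ((size Q).-1%:R)%:P /\ size Q^`() = (size Q).-1.
Proof.
move=> Qm Q1; have lc : Q^`()`_(size Q).-2 = ((size Q).-1%:R)%:P.
  rewrite coef_deriv; have -> : (size Q).-2.+1 = (size Q).-1 by lia.
  by rewrite -lead_coefE (monicP Qm) rmorph_nat.
have lt : (size Q^`() <= (size Q).-1)%N.
  have := lt_size_deriv (monic_neq0 Qm).
  by move: (size Q^`()) (size Q) => a b; lia.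
have eqs : size Q^`() = (size Q).-1.
  apply/eqP; rewrite eqn_leq lt /= leqNgt; apply/negP => lt2.
  have : Q^`()`_(size Q).-2 = 0.
    apply: nth_default; move: lt2.
    by move: (size Q^`()) (size Q) => a b; lia.
  by rewrite lc => /eqP; rewrite polyC_eq0 pnatr_eq0; case: (size Q) Q1 => [|[|]].
by split=> //; rewrite lead_coefE eqs.
Qed.

(** Taking slices preserves the degrees of [Q] and of its derivative, because
    their leading coefficients are constants. *)
Lemma resultant_slice Q x : Q \is monic -> (1 < size Q)%N ->
  (resultant Q Q^`()).[x] = resultant (slice Q x) (slice Q x)^`().
Proof.
move=> Qm Q1; have [lc _] := lead_coef_deriv_monic Qm Q1.
rewrite deriv_slice /slice -map_resultant//.
  by rewrite (monicP Qm) rmorph1 oner_neq0.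
by rewrite lc /= /horner_eval hornerC pnatr_eq0; case: (size Q) Q1 => [|[|]].
Qed.

(** The resultant of [Q] and its derivative is a combination of the two, so it
    vanishes wherever both do. *)
Lemma simple_of_disc Q y x : Q \is monic -> (2 < size Q)%N ->
  (resultant Q Q^`()).[x] != 0 -> Q.[y, x] = 0 -> Q^`().[y, x] != 0.
Proof.
move=> Qm Q2 d0 Q0; apply: contraNneq d0 => Q'0.
have Q1 := ltnW Q2; have Q'1 : (1 < size Q^`())%N.
  by have [_ ->] := lead_coef_deriv_monic Qm Q1; case: (size Q) Q2 => [|[|]].
have [[u v] _ /= E] := resultant_in_ideal Q1 Q'1.
have /(congr1 (fun P => P.[y, x])) := E.
by rewrite hornerC !hornerE Q0 Q'0 !mulr0 addr0 => ->.
Qed.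

End Discriminant.

(** * Perturbation to a separable product *)

Section Patterns.
Context {R : realType} (I : finType) (d : nat).
Implicit Types (p q : I -> {poly {poly R}}).

Definition bidegree_le (p : {poly {poly R}}) (k : nat) :=
  ((size p <= k.+1) && (sizeY p <= k.+1))%N.

Definition sign_pattern p (z : R * R) : {ffun I -> bool} :=
  [ffun i => 0 <= (p i).[z.1, z.2]].

(** The roots of these polynomials are pairwise distinct, also for different
    [i]. The degree [d + 2] exceeds that of the polynomials to be perturbed,
    which makes the perturbation monic; it is at least 2, so that the derivative
    of the product is not constant, as [resultant_in_ideal] requires. *)
Definition split_poly (i : I) : {poly R} :=
  \prod_(k < d.+2) ('X - (enum_rank (i, k) : nat)%:R%:P).

Lemma split_poly_monic i : split_poly i \is monic.
Proof. by apply: monic_prod => k _; exact: monicXsubC. Qed.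

Lemma size_split_poly i : size (split_poly i) = d.+3.
Proof. by rewrite size_prod_XsubC /index_enum -enumT size_enum_ord. Qed.

Lemma separable_split_poly : separable_poly (\prod_i split_poly i).
Proof.
rewrite /split_poly pair_big /=.
pose c (ik : I * 'I_d.+2) : R := (enum_rank ik : nat)%:R.
rewrite (eq_bigr (fun ik => 'X - (c ik)%:P)); last by case.
rewrite -(big_map c xpredT (fun r => 'X - r%:P)).
rewrite separable_prod_XsubC map_inj_uniq ?index_enum_uniq// => a b.
by move=> /eqP; rewrite eqr_nat => /eqP/val_inj/enum_rank_inj.
Qed.

(** For large [t] this has the sign of [q i] at a given point off the curve
    [q i = 0], while for [t = 0] it has distinct roots. *)
Definition perturb q (t : R) (i : I) : {poly {poly R}} :=
  (split_poly i)^:P + t%:P%:P * q i.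

Lemma horner_perturb q t i (y x : R) :
  (perturb q t i).[y, x] = (split_poly i).[y] + t * (q i).[y, x].
Proof.
rewrite /perturb hornerD hornerM hornerC hornerD hornerM hornerC.
by rewrite horner_map hornerC.
Qed.

Section Bounded.
Context q (qd : forall i, bidegree_le (q i) d).

Lemma perturb_monic t i :
  perturb q t i \is monic /\ size (perturb q t i) = d.+3.
Proof.
have sz : size (split_poly i)^:P = d.+3 by rewrite size_map_polyC size_split_poly.
have lt : (size (t%:P%:P * q i)%R < size (split_poly i)^:P)%N.
  rewrite sz mul_polyC; apply: leq_ltn_trans (size_scale_leq _ _) _.
  by have /andP[s _] := qd i; apply: leq_ltn_trans s _.
split; last by rewrite size_polyDl.
by rewrite monicE lead_coefDl// lead_coef_map_inj ?(monicP (split_poly_monic i))//; exact: polyC_inj.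
Qed.

Lemma prod_perturb_monic t : \prod_i perturb q t i \is monic.
Proof. by apply: monic_prod => i _; have [] := perturb_monic t i. Qed.

Lemma size_prod_perturb t :
  size (\prod_i perturb q t i) = (#|I| * d.+2).+1%N.
Proof.
rewrite size_prod => [|i _]; last by have [/monic_neq0] := perturb_monic t i.
rewrite (eq_bigr (fun=> d.+3)) => [|i _]; last by have [] := perturb_monic t i.
by rewrite sum_nat_const -[X in (_ - X)%N]/#|I| -[X in (X * _)%N]/#|I| !mulnS; lia.
Qed.

Lemma sizeY_prod_perturb t : (sizeY (\prod_i perturb q t i)%R <= (#|I| * d).+1)%N.
Proof.
rewrite sizeYE rmorph_prod /=.
apply: leq_trans (size_prod_le (e := fun=> d) _) _; last by rewrite sum_nat_const.
move=> i; rewrite rmorphD rmorphM /= !swapXY_polyC !map_polyC /= swapXY_map_polyC.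
apply: leq_trans (size_polyD _ _) _; rewrite geq_max; apply/andP; split.
  by rewrite size_polyC; case: eqP.
rewrite mul_polyC; apply: leq_trans (size_scale_leq _ _) _.
by rewrite -sizeYE; have /andP[] := qd i.
Qed.

(** The product of the perturbations, restricted to the line [x = 0], with [t]
    as the inner variable. *)
Definition perturb_at0 : {poly {poly R}} :=
  \prod_i ((split_poly i)^:P + 'X%:P * (slice (q i) 0)^:P).

Lemma slice_polyC (r : {poly R}) x : slice r^:P x = r.
Proof.
rewrite /slice -map_poly_comp; apply: map_poly_id => c _ /=.
by rewrite /horner_eval hornerC.
Qed.

Lemma slice_perturb_at0 t :
  slice perturb_at0 t = slice (\prod_i perturb q t i) 0.
Proof.
rewrite /slice !rmorph_prod /=; apply: eq_bigr => i _.
rewrite !rmorphD !rmorphM /= -!/(slice _ _) !slice_polyC.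
by rewrite /slice !map_polyC /= /horner_eval hornerX hornerC.
Qed.
End Bounded.
End Patterns.

(** * The number of sign patterns *)

Section CountPatterns.
Context {R : realType} (I : finType) (d : nat).
Implicit Types (p q : I -> {poly {poly R}}).

(** On the line [x = 0] the discriminant of the product is a polynomial in [t],
    and it is not zero for [t = 0], where the product has simple roots. So it is
    not zero for all large [t]. *)
Lemma perturb_disc_neq0 q : (forall i, bidegree_le (q i) d) -> (0 < #|I|)%N ->
  \forall t \near +oo%R,
    resultant (\prod_i perturb d q t i) (\prod_i perturb d q t i)^`() != 0.
Proof.
move=> qd I0.
have Q0m : perturb_at0 d q \is monic.
  apply: monic_prod => i _; rewrite monicE lead_coefDl.
    rewrite lead_coef_map_inj; [|exact: polyC_inj|by []].
    by rewrite (monicP (split_poly_monic d i)).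
  rewrite mul_polyC size_map_polyC size_split_poly.
  apply: leq_ltn_trans (size_scale_leq _ _) _; rewrite size_map_polyC.
  apply: leq_ltn_trans (size_poly _ _) _.
  by have /andP[s _] := qd i; apply: leq_ltn_trans s _.
have sz t : (1 < size (\prod_i perturb d q t i)%R)%N.
  by rewrite size_prod_perturb//; nia.
have sz0 : (1 < size (perturb_at0 d q))%N.
  rewrite -(size_slice 0 Q0m) (slice_perturb_at0 d q) size_slice ?sz//.
  exact: prod_perturb_monic.
pose D := resultant (perturb_at0 d q) (perturb_at0 d q)^`().
have D0 : D.[0] != 0.
  rewrite /D resultant_slice// resultant_eq0 -leqNgt.
  have -> : slice (perturb_at0 d q) 0 = \prod_(i : I) split_poly d i.
    rewrite /slice rmorph_prod /=; apply: eq_bigr => i _.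
    rewrite rmorphD rmorphM /= -!/(slice _ _) !slice_polyC.
    by rewrite /slice map_polyC /= /horner_eval hornerX mul0r addr0.
  have := @separable_split_poly R I d.
  by rewrite separable_poly.unlock /coprimep => /eqP ->.
have Dn0 : D != 0 by apply: contraNneq D0 => ->; rewrite horner0.
have := @nbhs_pinfty_ge R (cauchy_bound D) (num_real _).
apply: filterS => t tD; apply: contraTneq isT => Et.
have : D.[t] = 0.
  rewrite /D resultant_slice// slice_perturb_at0 -resultant_slice ?Et ?horner0//.
  exact: prod_perturb_monic.
move=> /(cauchy_boundP Dn0); rewrite ltNge => /negP[].
by apply: le_trans tD (ler_norm _).
Qed.

Lemma sign_perturb q (z : R * R) i : (q i).[z.1, z.2] != 0 ->
  \forall t \near +oo%R, (perturb d q t i).[z.1, z.2] != 0 /\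
    (0 <= (perturb d q t i).[z.1, z.2]) = (0 <= (q i).[z.1, z.2]).
Proof.
set v := (q i).[_, _] => v0; set r := (split_poly d i).[z.1].
have := @nbhs_pinfty_gt R (`|r| / `|v|) (num_real _).
apply: filterS => t; rewrite ltr_pdivrMr ?normr_gt0// => rt.
rewrite horner_perturb -/v -/r.
have [rr1 rr2] : - `|r| <= r /\ r <= `|r|.
  by rewrite ler_norm lerNl -normrN ler_norm.
have [v1|v1|v1] := ltgtP v 0; last by rewrite v1 eqxx in v0.
- rewrite (ltr0_norm v1) mulrN in rt.
  have lt0 : r + t * v < 0 by lra.
  by rewrite lt_eqF// [LHS]leNgt lt0.
- rewrite (gtr0_norm v1) in rt; have gt0 : 0 < r + t * v by lra.
  by rewrite gt_eqF// ltW.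
Qed.

(** A small positive shift makes a strict inequality of [0 <= p i] without
    changing its outcome. *)
Lemma sign_shift p (z : R * R) i :
  \forall e \near 0^'+, (p i + e%:P%:P).[z.1, z.2] != 0 /\
    (0 <= (p i + e%:P%:P).[z.1, z.2]) = (0 <= (p i).[z.1, z.2]).
Proof.
set v := (p i).[z.1, z.2].
have vE e : (p i + e%:P%:P).[z.1, z.2] = v + e.
  by rewrite hornerD hornerC hornerD hornerC.
have [v0|v0] := leP 0 v.
  near=> e; have e0 : 0 < e by near: e; exact: nbhs_right_gt.
  by rewrite vE gt_eqF ?ltr_wpDl// addr_ge0// ltW.
near=> e; have e0 : e < - v by near: e; apply: nbhs_right_lt; rewrite oppr_gt0.
have lt0 : v + e < 0 by lra.
by rewrite vE lt_eqF// leNgt lt0.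
Unshelve. all: by end_near. Qed.

(** One point is chosen for each realized pattern. The shift and then the
    perturbation are chosen so as to keep the outcomes at these finitely many
    points, and reduce the count to that of the colours of the complement of the
    curve [Q = 0]. The chosen points may lie over roots of the discriminant, but
    then they can be moved horizontally. *)
Theorem few_sign_patterns p : (forall i, bidegree_le (p i) d) ->
  few setT (sign_pattern p) (2 * (#|I| * d.+2).+1 ^ 3).
Proof.
move=> pd; have [I0|I0] := posnP #|I|.
  exists (fun=> 0%N); split=> [z _|z z' _ _ _]; first by rewrite I0.
  by apply/ffunP => i; have := card0_eq I0 i.
pose S : {set {ffun I -> bool}} :=
  finset (fun s => `[< exists z, sign_pattern p z = s >]).
have S_few : few setT (sign_pattern p) #|S|.
  by apply: few_set => z _; rewrite inE; apply/asboolP; exists z.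
apply: few_le S_few.
have /choice [w wP] (s : {ffun I -> bool}) : exists z : R * R,
    s \in S -> sign_pattern p z = s.
  have [|_] := boolP (s \in S); last by exists (0, 0).
  by rewrite inE => /asboolP[z]; exists z.
have shift (si : {ffun I -> bool} * I) := sign_shift p (w si.1) si.2.
have [e eP] := filter_ex (filter_forall (at_right_proper_filter 0) shift).
pose q i := p i + e%:P%:P.
have qd i : bidegree_le (q i) d.
  have /andP[pd1 pd2] := pd i; apply/andP; split.
    apply: leq_trans (size_polyD _ _) _; rewrite geq_max pd1.
    by rewrite size_polyC; case: eqP.
  rewrite sizeYE rmorphD /=; apply: leq_trans (size_polyD _ _) _.
  rewrite geq_max -sizeYE pd2 swapXY_polyC map_polyC /=.
  by rewrite size_polyC; case: eqP.
have pert (si : {ffun I -> bool} * I) :=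
  @sign_perturb q (w si.1) si.2 (proj1 (eP si)).
have [t [disc0 tP]] := filter_ex
  (filterI (perturb_disc_neq0 qd I0) (filter_forall proper_pinfty_nbhs pert)).
pose Q := \prod_i perturb d q t i; set disc := resultant _ _ in disc0.
pose h y x := sign_pattern (perturb d q t) (y, x).
have factor y x : Q.[y, x] != 0 -> forall i, (perturb d q t i).[y, x] != 0.
  by rewrite /Q !horner_prod => /prodf_neq0 Q0 i; exact: Q0.
have hV a b x : a <= b ->
    (forall c, a <= c <= b -> Q.[c, x] != 0) -> h a x = h b x.
  move=> ab Qn; apply/ffunP => i; rewrite !ffunE -!horner_slice.
  by apply: same_sign_of_noroot => // c /Qn /factor; rewrite horner_slice.
have hH a b y : a <= b ->
    (forall c, a <= c <= b -> Q.[y, c] != 0) -> h y a = h y b.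
  move=> ab Qn; apply/ffunP => i; rewrite !ffunE.
  by apply: same_sign_of_noroot => // c /Qn /factor.
have Qm : Q \is monic by exact: prod_perturb_monic.
have Qsz : size Q = (#|I| * d.+2).+1%N by exact: size_prod_perturb.
have Q2 : (2 < size Q)%N by rewrite Qsz; nia.
have few_h := few_colours hV hH Qm disc0 (fun y x => simple_of_disc Qm Q2).
apply: (@leq_trans (size disc * size Q)).
  apply: (few_card few_h) => s sS.
  have Qw : Q.[(w s).1, (w s).2] != 0.
    rewrite /Q !horner_prod; apply/prodf_neq0 => i _.
    by have [] := tP (s, i).
  have [r r0 rP] := box_neq0 Qw.
  have [rs _ rsP] := roots_seq disc0.
  have [x /andP[x1 x2] xrs] : exists2 x, (w s).2 < x < (w s).2 + r & x \notin rs.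
    by apply: avoid_seq; rewrite ltrDl.
  have xr : `|x - (w s).2| < r by rewrite ltr_distl; apply/andP; split; lra.
  have yr : `|(w s).1 - (w s).1| < r by rewrite subrr normr0.
  exists ((w s).1, x) => /=; first by split; [exact: rP|rewrite -rsP].
  rewrite (colour_move_x hH xr) => [|x' x'r]; last exact: rP.
  rewrite -[RHS](wP s sS); apply/ffunP => i; rewrite !ffunE /=.
  by have [_ ->] := tP (s, i); have [_ ->] := eP (s, i).
rewrite Qsz; have dsz : (size disc <= (2 * (#|I| * d.+2) * (#|I| * d)).+1)%N.
  have [lc sz'] := lead_coef_deriv_monic Qm (ltnW Q2).
  have sQ := sizeY_prod_perturb qd t.
  have sQ' : (sizeY Q^`() <= (#|I| * d).+1)%N.
    apply/bigmax_leqP => i _; rewrite coef_deriv -mulr_natl -polyC_natr mul_polyC.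
    apply: leq_trans (size_scale_leq _ _) _.
    exact: leq_trans (max_size_coefXY _ _) sQ.
  apply: leq_trans (size_resultant_le sQ sQ') _.
  by rewrite sz' Qsz /= ltnS leq_mul2r; apply/orP; right; lia.
apply: leq_trans (leq_mul dsz (leqnn _)) _.
have : (#|I| * d <= #|I| * d.+2)%N by rewrite leq_mul2l; apply/orP; right; lia.
move: (#|I| * d.+2)%N (#|I| * d)%N => m k km; rewrite !expnS expn0.
by nia.
Qed.

End CountPatterns.

(** * Polynomial functions of the parameters *)

Section PolynomialFunctions.
Context {R : realType}.
Implicit Types (f g : R * R -> R) (d : nat).

Definition polyfun d f : Prop :=
  exists2 p, bidegree_le p d & forall z, f z = p.[z.1, z.2].

Lemma polyfun_eq d f g : f =1 g -> polyfun d f -> polyfun d g.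
Proof. by move=> fg [p pd pE]; exists p => // z; rewrite -fg. Qed.

Lemma polyfun_le d d' f : (d <= d')%N -> polyfun d f -> polyfun d' f.
Proof.
move=> dd' [p /andP[p1 p2] pE]; exists p => //.
by rewrite /bidegree_le (leq_trans p1) ?(leq_trans p2).
Qed.

Lemma polyfun_cst d (c : R) : polyfun d (fun=> c).
Proof.
exists c%:P%:P => [|z]; last by rewrite !hornerC.
rewrite /bidegree_le sizeYE swapXY_polyC map_polyC /= !size_polyC.
by apply/andP; split; apply: leq_trans (leq_b1 _) _.
Qed.

Lemma polyfun_fst : polyfun 1 (fun z => z.1).
Proof.
exists 'X => [|z]; last by rewrite hornerX hornerC.
by rewrite /bidegree_le sizeYE swapXY_X size_polyX size_polyC polyX_eq0.
Qed.

Lemma polyfun_snd : polyfun 1 (fun z => z.2).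
Proof.
exists 'Y => [|z]; last by rewrite hornerC hornerX.
by rewrite /bidegree_le sizeYE swapXY_Y size_polyX size_polyC polyX_eq0.
Qed.

Lemma polyfunD d f g :
  polyfun d f -> polyfun d g -> polyfun d (fun z => f z + g z).
Proof.
move=> [p /andP[p1 p2] pE] [q /andP[q1 q2] qE].
exists (p + q) => [|z]; last by rewrite pE qE !hornerD.
rewrite sizeYE in p2; rewrite sizeYE in q2.
rewrite /bidegree_le sizeYE rmorphD /=; apply/andP.
by split; apply: leq_trans (size_polyD _ _) _; rewrite geq_max ?p1 ?p2.
Qed.

Lemma polyfunM d1 d2 f g :
  polyfun d1 f -> polyfun d2 g -> polyfun (d1 + d2) (fun z => f z * g z).
Proof.
move=> [p /andP[p1 p2] pE] [q /andP[q1 q2] qE].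
exists (p * q) => [|z]; last by rewrite pE qE !hornerM.
rewrite sizeYE in p2; rewrite sizeYE in q2.
rewrite /bidegree_le sizeYE rmorphM /=; apply/andP.
split; apply: leq_trans (size_polyMleq _ _) _.
  by move: p1 q1; move: (size p) (size q) => a b; lia.
by move: p2 q2; move: (size (swapXY p)) (size (swapXY q)) => a b; lia.
Qed.

Lemma polyfunZ d (c : R) f : polyfun d f -> polyfun d (fun z => c * f z).
Proof. by rewrite -{2}[d]add0n => fd; apply: polyfunM => //; exact: polyfun_cst. Qed.

Lemma polyfunB d f g :
  polyfun d f -> polyfun d g -> polyfun d (fun z => f z - g z).
Proof.
move=> fd gd; apply: polyfunD => //.
by apply: polyfun_eq (polyfunZ (-1) gd) => z; rewrite mulN1r.
Qed.

Lemma polyfun_sum d (J : finType) (F : J -> R * R -> R) :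
  (forall j, polyfun d (F j)) -> polyfun d (fun z => \sum_j F j z).
Proof.
move=> Fd; rewrite (_ : (fun z => _) = \sum_j F j); last first.
  by apply/funext => z; rewrite fct_sumE.
elim/big_ind: _ => [|f g fd gd|j _]; last exact: Fd.
  exact: (polyfun_cst _ 0).
exact: polyfunD.
Qed.

Lemma polyfun_if d (b : bool) f g :
  polyfun d f -> polyfun d g -> polyfun d (fun z => if b then f z else g z).
Proof. by case: b. Qed.

Lemma polyfun_mulmx d (m n : nat) (A : 'M[R]_(m, n)) (v : R * R -> 'cV[R]_n) i :
  (forall j, polyfun d (fun z => v z j 0)) ->
  polyfun d (fun z => (A *m v z) i 0).
Proof.
move=> vd; apply: (polyfun_eq (f := fun z => \sum_j A i j * v z j 0)).
  by move=> z; rewrite mxE.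
by apply: polyfun_sum => j; exact: polyfunZ.
Qed.

End PolynomialFunctions.

(** * Computations that branch on signs of polynomials *)

Section Piecewise.
Context {R : realType} (K : finType).

(** The functions [F z] are the pieces: there are at most [M] of them, all of
    the class [V], and [F z] is one that agrees with [f] at [z]. Here [f] gives
    the states of a family [K] of computations with the same parameters. *)
Definition piecewise (S : Type) (V : K -> (R * R -> S) -> Prop) (M : nat)
    (f : R * R -> K -> S) : Prop :=
  exists F : R * R -> R * R -> K -> S,
    [/\ few setT F M, forall z, F z z = f z &
        forall z k, V k (fun z' => F z z' k)].

Lemma piecewise_le (S : Type) (V : K -> (R * R -> S) -> Prop) (M M' : nat)
    (f : R * R -> K -> S) :
  (M <= M')%N -> piecewise V M f -> piecewise V M' f.
Proof. by move=> MM' [F [fF Ff FV]]; exists F; split=> //; exact: few_le fF. Qed.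

Definition branch_bound (s d : nat) : nat := 2 * (s * d.+2).+1 ^ 3.

Lemma branch_bound_le s s' d d' : (s <= s')%N -> (d <= d')%N ->
  (branch_bound s d <= branch_bound s' d')%N.
Proof.
by move=> ss dd; rewrite /branch_bound leq_mul2l /= leq_exp2r// ltnS leq_mul.
Qed.

(** On the set of parameters where the piece is a given one, the tests are
    polynomials that do not depend on the parameters otherwise, and
    [few_sign_patterns] applies. *)
Lemma few_branches (S : Type) (V : K -> (R * R -> S) -> Prop) (M : nat)
    (f : R * R -> K -> S) (J : finType) (d : nat)
    (test : K -> S -> R * R -> J -> R) :
  piecewise V M f ->
  (forall k xi j, V k xi -> polyfun d (fun z => test k (xi z) z j)) ->
  exists F : R * R -> R * R -> K -> S,
    [/\ forall z, F z z = f z, forall z k, V k (fun z' => F z z' k) &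
      few setT
        (fun z => (F z, [ffun kj : K * J => 0 <= test kj.1 (f z kj.1) z kj.2]))
        (M * branch_bound (#|K| * #|J|) d)].
Proof.
move=> [F [fF Ff FV]] testd; exists F; split=> //.
apply: few_pair fF _ => z0 _.
have /choice[p pP] (kj : K * J) : exists p, bidegree_le p d /\
    forall z, test kj.1 (F z0 z kj.1) z kj.2 = p.[z.1, z.2].
  by have [p pd pE] := testd kj.1 _ kj.2 (FV z0 kj.1); exists p.
have [g [gM gP]] := few_sign_patterns (fun kj => proj1 (pP kj)).
exists g; split=> [z _|z z' [_ Fz] [_ Fz'] gz].
  by rewrite /branch_bound -card_prod gM.
have pat w : F w = F z0 ->
    [ffun kj : K * J => 0 <= test kj.1 (f w kj.1) w kj.2] = sign_pattern p w.
  move=> Fw; apply/ffunP => kj; rewrite !ffunE -(proj2 (pP kj)).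
  by rewrite -Ff Fw.
by rewrite !pat//; exact: gP.
Qed.

(** One batch of comparisons, followed by a computation that depends on their
    outcomes. *)
Lemma piecewise_step (S S' : Type) (V : K -> (R * R -> S) -> Prop)
    (V' : K -> (R * R -> S') -> Prop) (M : nat) (f : R * R -> K -> S)
    (J : finType) (d : nat) (test : K -> S -> R * R -> J -> R)
    (sel : K -> (J -> bool) -> S -> R * R -> S') (h : R * R -> K -> S') :
  piecewise V M f ->
  (forall k xi j, V k xi -> polyfun d (fun z => test k (xi z) z j)) ->
  (forall k b xi, V k xi -> V' k (fun z => sel k b (xi z) z)) ->
  (forall z k, h z k = sel k (fun j => 0 <= test k (f z k) z j) (f z k) z) ->
  piecewise V' (M * branch_bound (#|K| * #|J|) d) h.
Proof.
move=> /few_branches /[apply] -[F [Ff FV fF]] selV hE.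
pose G (Fb : (R * R -> K -> S) * {ffun K * J -> bool}) (z' : R * R) (k : K) :=
  sel k (fun j => Fb.2 (k, j)) (Fb.1 z' k) z'.
exists (fun z => G (F z, [ffun kj : K * J => 0 <= test kj.1 (f z kj.1) z kj.2])).
split; first exact: (few_comp G fF).
- move=> z; apply/funext => k; rewrite hE /G /= Ff; congr (sel k _ _ _).
  by apply/funext => j; rewrite ffunE.
- by move=> z k; apply: selV; exact: FV.
Qed.

End Piecewise.

(** * The projections as case distinctions *)

Lemma colB (A : zmodType) (n : nat) (v w : 'cV[A]_n) i :
  (v - w) i 0 = v i 0 - w i 0.
Proof. by rewrite !mxE. Qed.

Section ClosedForms.
Context {R : realType} {n m1 m2 : nat} (I : lp R n m1 m2).
Implicit Types (y : 'cV[R]_(m1 + m2)).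

(** The clamped value is either the argument, encoded as [None], or one of
    finitely many constants; [b1] and [b2] tell whether the argument is above
    the lower and below the upper bound. *)
Definition clamp_case (l u : \bar R) (b1 b2 : bool) : option R :=
  match (if l is r%:E then if b1 then None else Some r else None) with
  | None => if u is r%:E then if b2 then None else Some r else None
  | Some r => Some (fine (Order.min r%:E u))
  end.

Lemma clampE (l u : \bar R) (w : R) : (l < +oo)%E -> (-oo < u)%E ->
  fine (Order.min (Order.max w%:E l) u) =
  odflt w (clamp_case l u (0 <= w - fine l) (0 <= fine u - w)).
Proof.
rewrite /clamp_case; case: l => [l| |] //= _; case: u => [u| |] //= _;
  rewrite ?subr_ge0 ?maxeNy ?miney ?mineNy //=.
- rewrite -EFin_max; case: (leP l w) => lw /=; rewrite -EFin_min /=.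
    by case: (leP w u) => wu /=.
  by [].
- by rewrite -EFin_max; case: (leP l w) => _; rewrite ?miney.
- by rewrite -EFin_min /=; case: (leP w u).
Qed.

Definition reduced_cost y : 'cV[R]_n := lp_c I - (lp_K I)^T *m y.

(** Whether the projection onto [Lambda] keeps a reduced cost, whose sign is
    nonnegative if [b] holds, or sends it to zero. *)
Definition keeps_slack (l u : \bar R) (b : bool) : bool :=
  match l, u with
  | -oo%E, +oo%E => false
  | -oo%E, _ => ~~ b
  | _, +oo%E => b
  | _, _ => true
  end.

Definition slack_case (i : 'I_n) (b : bool) (r : R) : R :=
  if keeps_slack (lp_l I i 0) (lp_u I i 0) b then r else 0.

Lemma slack_case_nearest (i : 'I_n) (r : R) :
  let s := slack_case i (0 <= r) r in
  [/\ Lambda I i s, (forall a, Lambda I i a -> (r - s) ^+ 2 <= (r - a) ^+ 2) &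
      (forall a, Lambda I i a -> (r - a) ^+ 2 = (r - s) ^+ 2 -> a = s)].
Proof.
rewrite /slack_case /keeps_slack /Lambda /=.
have id_case (P : set R) : P r ->
    [/\ P r, (forall a, P a -> (r - r) ^+ 2 <= (r - a) ^+ 2) &
      (forall a, P a -> (r - a) ^+ 2 = (r - r) ^+ 2 -> a = r)].
  move=> Pr; split=> // a _; rewrite subrr expr0n ?sqr_ge0//= => /eqP.
  by rewrite sqrf_eq0 subr_eq0 => /eqP.
have neg_case : let s := if ~~ (0 <= r) then r else 0 in
    [/\ s <= 0, (forall a, a <= 0 -> (r - s) ^+ 2 <= (r - a) ^+ 2) &
      (forall a, a <= 0 -> (r - a) ^+ 2 = (r - s) ^+ 2 -> a = s)].
  case: (leP 0 r) => r0 /=; last by apply: (id_case [set a | a <= 0]); exact: ltW.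
  split=> // a a0; rewrite subr0; first by nra.
  by move=> E; apply/eqP; rewrite -sqrf_eq0 eq_le sqr_ge0 andbT; nra.
have pos_case : let s := if 0 <= r then r else 0 in
    [/\ 0 <= s, (forall a, 0 <= a -> (r - s) ^+ 2 <= (r - a) ^+ 2) &
      (forall a, 0 <= a -> (r - a) ^+ 2 = (r - s) ^+ 2 -> a = s)].
  case: (leP 0 r) => r0 /=; first exact: (id_case [set a | 0 <= a]).
  split=> // a a0; rewrite subr0; first by nra.
  by move=> E; apply/eqP; rewrite -sqrf_eq0 eq_le sqr_ge0 andbT; nra.
case: (lp_l I i 0) => [l| |]; case: (lp_u I i 0) => [u| |] //;
  try exact: (id_case setT).
by split=> // a /= ->.
Qed.

(** The admissible set is a product of intervals and the squared distance is a sum over the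
    coordinates, so the nearest point is unique, and nearest in each
    coordinate. *)
Lemma dual_slackE y :
  dual_slack I y =
  \col_i slack_case i (0 <= reduced_cost y i 0) (reduced_cost y i 0).
Proof.
rewrite /dual_slack -/(reduced_cost y); move: (reduced_cost y) => v.
set w0 := \col_i _; set S := (S in euclid_proj S v).
have near0 i := slack_case_nearest i (v i 0).
have w0E i : w0 i 0 = slack_case i (0 <= v i 0) (v i 0) by rewrite mxE.
have Sw0 : S w0 by move=> i; rewrite w0E; have [] := near0 i.
have term i w' : S w' -> (v - w0) i 0 ^+ 2 <= (v - w') i 0 ^+ 2.
  move=> Sw'; rewrite !colB w0E.
  by have [_ le _] := near0 i; exact: le.
have nw0 : nearest S v w0.
  split=> // w' Sw'; rewrite /norm2 ler_wsqrtr// ler_sum// => i _.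
  exact: term.
have [Sw /(_ w0 Sw0)] := xgetPex v (ex_intro _ w0 nw0).
rewrite -/(euclid_proj S v); set w := euclid_proj S v in Sw *.
rewrite /norm2 ler_sqrt ?sumr_ge0// => [le|i _]; last exact: sqr_ge0.
have sum0 : \sum_i ((v - w) i 0 ^+ 2 - (v - w0) i 0 ^+ 2) = 0.
  apply/eqP; rewrite eq_le sumr_ge0 => [|i _]; last by rewrite subr_ge0 term.
  by rewrite sumrB subr_le0 le.
apply/colP => i; rewrite w0E; have [_ _ uniq0] := near0 i; apply: uniq0 => //.
have dif j : 0 <= (v - w) j 0 ^+ 2 - (v - w0) j 0 ^+ 2 by rewrite subr_ge0 term.
have /(_ i isT)/eqP := psumr_eq0P (fun j _ => dif j) sum0.
by rewrite subr_eq0 !colB w0E => /eqP.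
Qed.

End ClosedForms.

(** * The stopping rule as a case distinction *)

Section TerminationTests.
Context {R : realType} {n m1 m2 : nat} (I : lp R n m1 m2).
Local Notation state := ('cV[R]_n * 'cV[R]_(m1 + m2))%type.

(** Once the signs of these quantities are known, the stopping rule compares
    polynomials in the iterate, up to absolute values. *)
Definition kink (s : state) (j : 'I_n + 'I_m1) : R :=
  match j with
  | inl i => reduced_cost I s.2 i 0
  | inr k => (lp_h I - lp_G I *m s.1) k 0
  end.

(** The quantities that the stopping rule compares (residuals are squared),
    given that [b] tells which kinks are nonnegative. *)
Section Measures.
Context (b : 'I_n + 'I_m1 -> bool) (s : state).

Definition slack_at i : R :=
  slack_case I i (b (inl i)) (reduced_cost I s.2 i 0).

Definition dual_value : R :=
  dotv (lp_q I) s.2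
  + \sum_i fine (lp_l I i 0) * (if b (inl i) then slack_at i else 0)
  - \sum_i fine (lp_u I i 0) * (if b (inl i) then 0 else - slack_at i).

Definition primal_residual : R :=
  \sum_i (lp_A I *m s.1 - lp_b I) i 0 ^+ 2
  + \sum_k (if b (inr k) then (lp_h I - lp_G I *m s.1) k 0 else 0) ^+ 2.

Definition dual_residual : R :=
  \sum_i (reduced_cost I s.2 i 0 - slack_at i) ^+ 2.

Definition measures : R * R * R * R :=
  (dual_value, dotv (lp_c I) s.1, primal_residual, dual_residual).
End Measures.

(** The signs [e1] and [e2] stand for the choice of a branch of the two absolute
    values on the right of the gap criterion, which holds if and only if for
    some choice the tests with both values of [e3] succeed. *)
Definition stop_test (tol : R) (v : R * R * R * R)
    (j : bool * bool * bool + bool) : R :=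
  match j with
  | inl (e1, e2, e3) =>
      tol * (1 + (-1) ^+ e1 * v.1.1.1 + (-1) ^+ e2 * v.1.1.2)
      + (-1) ^+ e3 * (v.1.1.1 - v.1.1.2)
  | inr true => (tol * (1 + norm2 (lp_q I))) ^+ 2 - v.1.2
  | inr false => (tol * (1 + norm2 (lp_c I))) ^+ 2 - v.2
  end.

Definition stops (b : bool * bool * bool + bool -> bool) : bool :=
  [&& [exists e : bool * bool,
         b (inl (e.1, e.2, true)) && b (inl (e.1, e.2, false))],
      b (inr true) & b (inr false)].

Lemma sqr_norm2 k (v : 'cV[R]_k) : norm2 v ^+ 2 = \sum_i v i 0 ^+ 2.
Proof. by rewrite sqr_sqrtr// sumr_ge0// => i _; exact: sqr_ge0. Qed.

Lemma norm2_ge0 k (v : 'cV[R]_k) : 0 <= norm2 v.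
Proof. exact: sqrtr_ge0. Qed.

Lemma sqrt_le_sqr (a r : R) : 0 <= r -> (Num.sqrt a <= r) = (a <= r ^+ 2).
Proof. by move=> r0; rewrite -(ler_sqrt a (sqr_ge0 r)) sqrtr_sqr ger0_norm. Qed.

Lemma gap_le_exists (tol D P : R) : 0 < tol ->
  (`|D - P| <= tol * (1 + `|D| + `|P|)) =
  [exists e : bool * bool,
    (0 <= stop_test tol (D, P, 0, 0) (inl (e.1, e.2, true))) &&
    (0 <= stop_test tol (D, P, 0, 0) (inl (e.1, e.2, false)))].
Proof.
move=> tol0; have sgn (e : bool) (a : R) : (-1) ^+ e * a <= `|a|.
  by case: e; rewrite /= ?expr1 ?expr0 ?mulN1r ?mul1r ?ler_norm// -normrN ler_norm.
rewrite ler_norml; apply/idP/existsP => [/andP[le1 le2]|[[e1 e2] /= /andP[le1 le2]]].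
  exists (D < 0, P < 0); rewrite /= -!normrEsign; apply/andP; split; lra.
have le3 := sgn e1 D; have le4 := sgn e2 P.
have : tol * (1 + (-1) ^+ e1 * D + (-1) ^+ e2 * P) <= tol * (1 + `|D| + `|P|).
  by rewrite ler_pM2l//; lra.
by move=> le5; apply/andP; split; lra.
Qed.

Lemma pos_part_slack i (r : R) :
  pos_part (slack_case I i (0 <= r) r) =
  if 0 <= r then slack_case I i (0 <= r) r else 0.
Proof.
rewrite /pos_part /slack_case; case: (leP 0 r) => r0; case: ifP => _;
  by apply/max_idPl || apply/max_idPr; rewrite ?lexx// ltW.
Qed.

Lemma neg_part_slack i (r : R) :
  neg_part (slack_case I i (0 <= r) r) =
  if 0 <= r then 0 else - slack_case I i (0 <= r) r.
Proof.
rewrite /neg_part /slack_case; case: (leP 0 r) => r0; case: ifP => _;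
  rewrite ?oppr0 ?maxxx//.
  by apply/max_idPr; rewrite oppr_le0.
by apply/max_idPl; rewrite oppr_ge0 ltW.
Qed.

Lemma fine_mul_EFin (a : \bar R) (r : R) : fine (a * r%:E)%E = fine a * r.
Proof.
case: a => [a| |] //=; rewrite mul0r ?mulyr ?mulNyr;
  case: (sgrP r) => _; rewrite ?mul0e ?mul1e ?mulN1e //.
Qed.

Lemma dual_objE (s : state) :
  dual_obj I s.2 = dual_value (fun j => 0 <= kink s j) s.
Proof.
rewrite /dual_obj /dual_value dual_slackE; congr (_ + _ - _); apply: eq_bigr => i _.
  by rewrite fine_mul_EFin mxE pos_part_slack.
by rewrite fine_mul_EFin mxE neg_part_slack.
Qed.

Lemma terminateE tol (s : state) : 0 < tol ->
  terminate I tol s =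
  stops (fun j => 0 <= stop_test tol (measures (fun j => 0 <= kink s j) s) j).
Proof.
case: s => x y tol0; rewrite /terminate (dual_objE (x, y)).
have rhs_ge0 k (v : 'cV[R]_k) : 0 <= tol * (1 + norm2 v).
  by rewrite mulr_ge0 ?addr_ge0 ?norm2_ge0// ltW.
set b := fun j => 0 <= kink _ _; rewrite gap_le_exists// /stops; congr [&& _, _ & _].
  rewrite (sqrt_le_sqr _ (rhs_ge0 _ _)).
  rewrite /= subr_ge0 !sqr_norm2; congr (_ + _ <= _); apply: eq_bigr => k _.
  by rewrite mxE /pos_part /b /=; case: (leP 0 _).
rewrite (sqrt_le_sqr _ (rhs_ge0 _ _)).
rewrite /= subr_ge0; congr (_ <= _); apply: eq_bigr => k _.
rewrite -/(reduced_cost I y) colB dual_slackE; congr ((_ - _) ^+ 2).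
by rewrite mxE.
Qed.

End TerminationTests.

(** * One round of the algorithm on a family of instances *)

Section Iteration.
Context {R : realType} {n m1 m2 : nat}.
Local Notation state := ('cV[R]_n * 'cV[R]_(m1 + m2))%type.
Implicit Types (I : lp R n m1 m2) (s : state) (z : R * R).

Definition primal_arg I s z : 'cV[R]_n := s.1 - z.1 *: reduced_cost I s.2.

Definition dual_arg I (x' : 'cV[R]_n) s z : 'cV[R]_(m1 + m2) :=
  s.2 + z.2 *: (lp_q I - lp_K I *m (2 *: x' - s.1)).

Definition pdhg_map I z s : state :=
  let x' := projX I (primal_arg I s z) in (x', projY (dual_arg I x' s z)).

Lemma pdhg_iter I (eta omega : R) s t :
  pdhg I eta omega s t = iter t (pdhg_map I (eta / omega, eta * omega)) s.
Proof. by rewrite /pdhg; elim: t => //= t ->; case: (iter _ _ _). Qed.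

Definition clamp_test I s z (j : 'I_n * bool) : R :=
  if j.2 then primal_arg I s z j.1 0 - fine (lp_l I j.1 0)
  else fine (lp_u I j.1 0) - primal_arg I s z j.1 0.

Definition clamp_branch I (b : 'I_n * bool -> bool) s z : 'cV[R]_n :=
  \col_i odflt (primal_arg I s z i 0)
    (clamp_case (lp_l I i 0) (lp_u I i 0) (b (i, true)) (b (i, false))).

Lemma projX_branch I s z :
  projX I (primal_arg I s z) =
  clamp_branch I (fun j => 0 <= clamp_test I s z j) s z.
Proof.
apply/colP => i; rewrite [LHS]mxE [RHS]mxE clampE//.
  exact: lp_l_lty.
exact: lp_u_gtNy.
Qed.

Definition sign_test I (x' : 'cV[R]_n) s z (k : 'I_m1) : R :=
  dual_arg I x' s z (lshift m2 k) 0.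

Definition sign_branch I (b : 'I_m1 -> bool) (x' : 'cV[R]_n) s z :
    'cV[R]_(m1 + m2) :=
  col_mx (\col_k if b k then dual_arg I x' s z (lshift m2 k) 0 else 0)
    (dsubmx (dual_arg I x' s z)).

Lemma projY_branch I x' s z :
  projY (dual_arg I x' s z) =
  sign_branch I (fun k => 0 <= sign_test I x' s z k) x' s z.
Proof.
rewrite /projY /sign_branch; congr col_mx; apply/colP => k.
rewrite [LHS]mxE [RHS]mxE [usubmx _ _ _]mxE /sign_test.
by case: (leP 0 (dual_arg _ _ _ _ _ _)).
Qed.

Section Degrees.
Context (I : lp R n m1 m2).

Definition coords d k (v : R * R -> 'cV[R]_k) : Prop :=
  forall i, polyfun d (fun z => v z i 0).

Lemma coords_le d d' k (v : R * R -> 'cV[R]_k) : (d <= d')%N ->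
  coords d v -> coords d' v.
Proof. by move=> dd' vd i; exact: polyfun_le (vd i). Qed.

Lemma coords_cst d k (v : 'cV[R]_k) : coords d (fun=> v).
Proof. by move=> i; exact: polyfun_cst. Qed.

Lemma coordsB d k (v w : R * R -> 'cV[R]_k) :
  coords d v -> coords d w -> coords d (fun z => v z - w z).
Proof.
move=> vd wd i; apply: polyfun_eq (polyfunB (vd i) (wd i)) => z.
by rewrite colB.
Qed.

Lemma coordsD d k (v w : R * R -> 'cV[R]_k) :
  coords d v -> coords d w -> coords d (fun z => v z + w z).
Proof.
by move=> vd wd i; apply: polyfun_eq (polyfunD (vd i) (wd i)) => z; rewrite mxE.
Qed.

Lemma coords_mulmx d k l (A : 'M[R]_(l, k)) (v : R * R -> 'cV[R]_k) :
  coords d v -> coords d (fun z => A *m v z).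
Proof. by move=> vd i; exact: polyfun_mulmx. Qed.

Lemma coordsZ d d' k (a : R * R -> R) (v : R * R -> 'cV[R]_k) :
  polyfun d a -> coords d' v -> coords (d + d') (fun z => a z *: v z).
Proof.
by move=> ad vd i; apply: polyfun_eq (polyfunM ad (vd i)) => z; rewrite mxE.
Qed.

Definition state_degree d (xi : R * R -> state) : Prop :=
  coords d (fun z => (xi z).1) /\ coords d (fun z => (xi z).2).

Lemma reduced_cost_degree d (y : R * R -> 'cV[R]_(m1 + m2)) :
  coords d y -> coords d (fun z => reduced_cost I (y z)).
Proof. by move=> yd; apply: coordsB; [exact: coords_cst|exact: coords_mulmx]. Qed.

Lemma kink_degree d xi j : state_degree d xi ->
  polyfun d (fun z => kink I (xi z) j).
Proof.
move=> [xd yd]; case: j => [i|k]; first exact: reduced_cost_degree.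
by apply: coordsB; [exact: coords_cst|exact: coords_mulmx].
Qed.

Lemma dotv_degree d k (a : 'cV[R]_k) (v : R * R -> 'cV[R]_k) :
  coords d v -> polyfun d (fun z => dotv a (v z)).
Proof. by move=> vd; exact: polyfun_mulmx. Qed.

Lemma sqr_degree d f : polyfun d f -> polyfun (2 * d) (fun z => f z ^+ 2).
Proof. by move=> fd; rewrite mul2n -addnn; exact: polyfunM. Qed.

Lemma slack_degree d b xi i : state_degree d xi ->
  polyfun d (fun z => slack_at I b (xi z) i).
Proof.
move=> [_ yd]; apply: polyfun_if; last exact: polyfun_cst.
exact: reduced_cost_degree.
Qed.

Definition measures_degree d (v : R * R -> R * R * R * R) : Prop :=
  [/\ polyfun d (fun z => (v z).1.1.1), polyfun d (fun z => (v z).1.1.2),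
      polyfun d (fun z => (v z).1.2) & polyfun d (fun z => (v z).2)].

Lemma measures_degreeP d b xi : state_degree d xi ->
  measures_degree (2 * d) (fun z => measures I b (xi z)).
Proof.
move=> xid; have [xd yd] := xid; have dd : (d <= 2 * d)%N by lia.
have sl i := slack_degree b i xid.
split.
- apply: (polyfun_le dd); apply: polyfunB; first apply: polyfunD.
  + exact: dotv_degree.
  + apply: polyfun_sum => i; apply: polyfunZ.
    by apply: polyfun_if => //; exact: polyfun_cst.
  + apply: polyfun_sum => i; apply: polyfunZ.
    apply: polyfun_if; first exact: polyfun_cst.
    by apply: polyfun_eq (polyfunZ (-1) (sl i)) => z; rewrite mulN1r.
- by apply: (polyfun_le dd); exact: dotv_degree.
- apply: polyfunD; apply: polyfun_sum => i; apply: sqr_degree.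
    by apply: coordsB; [exact: coords_mulmx|exact: coords_cst].
  apply: polyfun_if; last exact: polyfun_cst.
  by apply: coordsB; [exact: coords_cst|exact: coords_mulmx].
- apply: polyfun_sum => i; apply: sqr_degree; apply: polyfunB => //.
  exact: reduced_cost_degree.
Qed.

Lemma stop_test_degree d tol v j : measures_degree d v ->
  polyfun d (fun z => stop_test I tol (v z) j).
Proof.
move=> [v1 v2 v3 v4]; case: j => [[[e1 e2] e3]|[]] /=.
- apply: polyfunD; last by apply: polyfunZ; exact: polyfunB.
  apply: polyfunZ; apply: polyfunD; last exact: polyfunZ.
  by apply: polyfunD; [exact: polyfun_cst|exact: polyfunZ].
- by apply: polyfunB => //; exact: polyfun_cst.
- by apply: polyfunB => //; exact: polyfun_cst.
Qed.

Lemma primal_arg_degree d xi : state_degree d xi ->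
  coords d.+1 (fun z => primal_arg I (xi z) z).
Proof.
move=> [xd yd]; apply: coordsB; first exact: coords_le xd.
by rewrite -add1n; apply: coordsZ; [exact: polyfun_fst|exact: reduced_cost_degree].
Qed.

Lemma clamp_test_degree d xi j : state_degree d xi ->
  polyfun d.+1 (fun z => clamp_test I (xi z) z j).
Proof.
move=> /primal_arg_degree pd; rewrite /clamp_test; case: j.2 => /=.
  by apply: polyfunB; [exact: pd|exact: polyfun_cst].
by apply: polyfunB; [exact: polyfun_cst|exact: pd].
Qed.

Lemma clamp_branch_degree d b xi : state_degree d xi ->
  coords d.+1 (fun z => clamp_branch I b (xi z) z).
Proof.
move=> /primal_arg_degree pd i.
apply: (polyfun_eq (f := fun z => odflt (primal_arg I (xi z) z i 0)
    (clamp_case (lp_l I i 0) (lp_u I i 0) (b (i, true)) (b (i, false))))).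
  by move=> z; rewrite [RHS]mxE.
by case: (clamp_case _ _ _ _) => [r|] /=; [exact: polyfun_cst|exact: pd].
Qed.

Lemma dual_arg_degree d (x' : R * R -> 'cV[R]_n) xi :
  coords d.+1 x' -> state_degree d xi ->
  coords d.+2 (fun z => dual_arg I (x' z) (xi z) z).
Proof.
move=> xd' [xd yd]; apply: coordsD; first exact: (coords_le (leqW (leqnSn d)) yd).
rewrite -(add1n d.+1); apply: coordsZ; first exact: polyfun_snd.
apply: coordsB; first exact: coords_cst.
apply: coords_mulmx; apply: coordsB; last exact: coords_le xd.
by apply: (coordsZ (d := 0)) => //; exact: polyfun_cst.
Qed.

Lemma sign_branch_degree d b (x' : R * R -> 'cV[R]_n) xi :
  coords d.+1 x' -> state_degree d xi ->
  coords d.+2 (fun z => sign_branch I b (x' z) (xi z) z).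
Proof.
move=> xd' xid; have dd := dual_arg_degree xd' xid; move=> i.
case: (split_ordP i) => k ->.
  apply: (polyfun_eq (f := fun z => if b k
      then dual_arg I (x' z) (xi z) z (lshift m2 k) 0 else 0)).
    by move=> z; rewrite col_mxEu [RHS]mxE.
  by apply: polyfun_if; [exact: dd|exact: polyfun_cst].
apply: polyfun_eq (dd (rshift m1 k)) => z.
by rewrite col_mxEd [RHS]mxE.
Qed.

End Degrees.

Lemma leq_mul4 (M a b c e B : nat) : (a <= B -> b <= B -> c <= B -> e <= B ->
  M * a * b * c * e <= M * B ^ 4)%N.
Proof.
by move=> aB bB cB eB; rewrite !expnSr expn0 mul1n !mulnA !leq_mul.
Qed.

Section Rounds.
Context (K : finType) (lps : K -> lp R n m1 m2) (tol : R) (tol0 : 0 < tol).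

(** The second component is a flag, which becomes [-1] when an iterate that
    satisfies the stopping rule is counted. As a real number it can be read by a
    sign test, like the iterates. *)
Definition round (counted : pred K) z (s : K -> state * R) (k : K) :
    state * R :=
  (pdhg_map (lps k) z (s k).1,
   if terminate (lps k) tol (s k).1 && counted k then -1 else (s k).2).

Definition flagged_degree d (k : K) (xi : R * R -> state * R) : Prop :=
  state_degree d (fun z => (xi z).1) /\ polyfun d (fun z => (xi z).2).

Definition round_bound d : nat :=
  branch_bound (#|K| * (2 * n + m1 + 10)) (2 * d + 2).

(** The four batches of comparisons are the kinks, the stopping rule, the clamp
    of the primal iterate and the sign of the dual iterate. The degree grows by
    one with the primal and by one with the dual step; the tests of the largest
    degrees, [2 * d] and [d + 2], are the squared residuals and the signs of the
    dual step. *)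
Lemma piecewise_round counted d M (f : R * R -> K -> state * R) :
  piecewise (flagged_degree d) M f ->
  piecewise (flagged_degree d.+2) (M * round_bound d ^ 4)
    (fun z => round counted z (f z)).
Proof.
move=> f_pw.
pose V1 (k : K) (xi : R * R -> state * R * (R * R * R * R)) :=
  flagged_degree d k (fun z => (xi z).1) /\
  measures_degree (2 * d) (fun z => (xi z).2).
pose f1 z k :=
  (f z k, measures (lps k) (fun j => 0 <= kink (lps k) (f z k).1 j) (f z k).1).
have f1_pw : piecewise V1 (M * branch_bound (#|K| * #|{: 'I_n + 'I_m1}|) d) f1.
  apply: (piecewise_step (V' := V1) (h := f1) (d := d)
    (test := fun k (s : state * R) _ (j : 'I_n + 'I_m1) => kink (lps k) s.1 j)
    (sel := fun k b (s : state * R) _ => (s, measures (lps k) b s.1)) f_pw) => //.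
  - by move=> k xi j [xid _]; exact: (kink_degree (lps k) j xid).
  - move=> k b xi xid; split=> //; case: xid => xid _.
    exact: (measures_degreeP (lps k) b xid).
pose f2 z k := ((f z k).1,
  if terminate (lps k) tol (f z k).1 && counted k then -1 else (f z k).2).
have f2_pw : piecewise (flagged_degree d)
    (M * branch_bound (#|K| * #|{: 'I_n + 'I_m1}|) d
    * branch_bound (#|K| * #|{: bool * bool * bool + bool}|) (2 * d)) f2.
  apply: (piecewise_step (V' := flagged_degree d) (h := f2) (d := 2 * d)
    (test := fun k (s : state * R * (R * R * R * R)) _
      (j : bool * bool * bool + bool) => stop_test (lps k) tol s.2 j)
    (sel := fun k b (s : state * R * (R * R * R * R)) _ =>
      (s.1.1, if stops b && counted k then -1 else s.1.2)) f1_pw).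
  - by move=> k xi j [_ vd]; exact: (stop_test_degree (lps k) tol j vd).
  - move=> k b xi [[xid fd] _]; split=> //=.
    by apply: polyfun_if => //; exact: polyfun_cst.
  - by move=> z k; rewrite /f2 terminateE.
pose V3 (k : K) (xi : R * R -> 'cV[R]_n * (state * R)) :=
  coords d.+1 (fun z => (xi z).1) /\ flagged_degree d k (fun z => (xi z).2).
pose f3 z k := (projX (lps k) (primal_arg (lps k) (f2 z k).1 z), f2 z k).
have f3_pw : piecewise V3 (M * branch_bound (#|K| * #|{: 'I_n + 'I_m1}|) d
    * branch_bound (#|K| * #|{: bool * bool * bool + bool}|) (2 * d)
    * branch_bound (#|K| * #|{: 'I_n * bool}|) d.+1) f3.
  apply: (piecewise_step (V' := V3) (h := f3) (d := d.+1)
    (test := fun k (s : state * R) z (j : 'I_n * bool) =>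
      clamp_test (lps k) s.1 z j)
    (sel := fun k b (s : state * R) z => (clamp_branch (lps k) b s.1 z, s)) f2_pw).
  - by move=> k xi j [xid _]; exact: (clamp_test_degree (lps k) j xid).
  - move=> k b xi xid; split=> //; case: xid => xid _.
    exact: (clamp_branch_degree (lps k) b xid).
  - by move=> z k; rewrite /f3 projX_branch.
apply: (@piecewise_le _ _ _ _ (M * branch_bound (#|K| * #|{: 'I_n + 'I_m1}|) d
    * branch_bound (#|K| * #|{: bool * bool * bool + bool}|) (2 * d)
    * branch_bound (#|K| * #|{: 'I_n * bool}|) d.+1
    * branch_bound (#|K| * #|'I_m1|) d.+2)).
  have bb (s e : nat) : (s <= 2 * n + m1 + 10)%N -> (e <= 2 * d + 2)%N ->
      (branch_bound (#|K| * s) e <= round_bound d)%N.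
    by move=> ss ee; apply: branch_bound_le ee; rewrite leq_mul2l ss orbT.
  by apply: leq_mul4; apply: bb;
    rewrite ?card_sum ?card_prod ?card_bool ?card_ord; lia.
apply: (piecewise_step (V' := flagged_degree d.+2) (d := d.+2)
  (test := fun k (s : 'cV[R]_n * (state * R)) z j =>
    sign_test (lps k) s.1 s.2.1 z j)
  (sel := fun k b (s : 'cV[R]_n * (state * R)) z =>
    ((s.1, sign_branch (lps k) b s.1 s.2.1 z), s.2.2)) f3_pw).
- move=> k xi j [xd [xid _]].
  exact: (dual_arg_degree (lps k) xd xid).
- move=> k b xi [xd [xid fd]]; split=> /=;
    last exact: (polyfun_le (leqW (leqnSn d)) fd).
  split; first exact: coords_le xd.
  exact: (sign_branch_degree (lps k) b xd xid).
- by move=> z k; rewrite /round /f3 /f2 /= /pdhg_map projY_branch.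
Qed.

End Rounds.
End Iteration.

(** * Shattered families of instances *)

Definition run_bound (n m1 N T : nat) : nat :=
  branch_bound (N * (2 * n + m1 + 10)) (4 * T).

Section Shattering.
Context {R : realType} {n m1 m2 : nat}.
Local Notation state := ('cV[R]_n * 'cV[R]_(m1 + m2))%type.

Lemma bigmin_lt (T : nat) (P : pred nat) (g : R) (r : seq nat) :
  ((\big[minn/T]_(t <- r | P t) t)%:R < g) =
  (T%:R < g) || has (fun t => P t && (t%:R < g)) r.
Proof.
elim: r => [|t r IH]; first by rewrite big_nil orbF.
rewrite big_cons /=; case: (P t) => /=; last exact: IH.
rewrite orbCA -IH; move: (\big[_/_]_(_ <- _ | _) _) => v.
rewrite /minn; case: ltnP => tv; apply/esym.
  by apply/orb_idr; apply: le_lt_trans; rewrite ler_nat ltnW.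
by apply/orb_idl; apply: le_lt_trans; rewrite ler_nat.
Qed.

Lemma pdhg_steps_lt (I : lp R n m1 m2) T tol (s : state) eta omega (g : R) :
  ((pdhg_steps I T tol s eta omega)%:R < g) =
  (T%:R < g) ||
  has (fun t => terminate I tol (pdhg I eta omega s t) && (t%:R < g)) (iota 0 T).
Proof.
rewrite /pdhg_steps -(big_mkord (fun t => terminate I tol (pdhg I eta omega s t)) id).
rewrite bigmin_lt /index_iota subn0 -(addn1 T) iotaD has_cat /= orbF add0n.
by case: (T%:R < g) => //=; rewrite andbF orbF.
Qed.

Section Run.
Context (N T : nat) (x : 'I_N -> lp R n m1 m2) (g : 'I_N -> R) (tol : R)
  (z0 : lp R n m1 m2 -> state) (tol0 : 0 < tol).

(** Only iterates before the threshold of their instance are counted, so the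
    final flags tell which numbers of steps are below their thresholds. *)
Fixpoint run (z : R * R) (t : nat) : 'I_N -> state * R :=
  if t is t'.+1 then round x tol (fun k => t'%:R < g k) z (run z t')
  else fun k => (z0 (x k), 1).

Lemma run_state z t k : (run z t k).1 = iter t (pdhg_map (x k) z) (z0 (x k)).
Proof. by elim: t => //= t IH; rewrite /round /= IH. Qed.

Lemma run_flag z t k :
  (0 <= (run z t k).2) =
  ~~ has (fun t => terminate (x k) tol (iter t (pdhg_map (x k) z) (z0 (x k)))
                   && (t%:R < g k)) (iota 0 t).
Proof.
elim: t => [|t IH]; first by rewrite /= ler01.
rewrite -[in RHS](addn1 t) iotaD has_cat negb_or -IH /= orbF add0n run_state.
by case: (_ && _); rewrite /= ?andbT// ler0N1 andbF.
Qed.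

Lemma piecewise_run t : (t <= T)%N ->
  piecewise (flagged_degree (2 * t)) (run_bound n m1 N T ^ (4 * t))
    (fun z => run z t).
Proof.
elim: t => [_|t IH tT].
  exists (fun _ _ k => (z0 (x k), 1)); split=> //.
    by exists (fun=> 0%N); split=> // z _; rewrite muln0 expn0.
  move=> z k; split; last exact: polyfun_cst.
  by split; exact: coords_cst.
have := piecewise_round x tol0 (fun k => t%:R < g k) (IH (ltnW tT)).
rewrite -[(2 * t).+2]addn2 -mulnSr; apply: piecewise_le.
rewrite mulnS addnC expnD leq_mul2l leq_exp2r//; apply/orP; right.
rewrite /round_bound card_ord; apply: branch_bound_le => //; lia.
Qed.

Lemma few_outcomes :
  few setT (fun z => [ffun k => 0 <= (run z T k).2])
    (run_bound n m1 N T ^ (4 * T).+1).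
Proof.
have [F [_ _]] := few_branches (J := unit) (d := 2 * T)
  (test := fun k (s : state * R) _ _ => s.2) (piecewise_run (leqnn T))
  (fun k xi _ xid => proj2 xid).
move=> [h [hM hP]]; exists h.
split=> [z /hM /leq_trans|z z' Dz Dz' /(hP _ _ Dz Dz') eqFb].
  apply; rewrite expnSr leq_mul2l; apply/orP; right.
  by apply: branch_bound_le; rewrite ?card_unit ?card_ord ?leq_mul2l; lia.
apply/ffunP => k; have /ffunP/(_ (k, tt)) := congr1 snd eqFb.
by rewrite !ffunE.
Qed.

End Run.

Lemma sgr_sign_lt0 (a : R) (b : bool) : Num.sg a = (-1) ^+ b -> (a < 0) = b.
Proof.
case: b => /eqP; rewrite ?expr1 ?expr0 sgr_cp0; first by [].
by move=> a0; rewrite ltNge ltW.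
Qed.

Lemma shattered_exp_le N T tol z0 (x : 'I_N -> lp R n m1 m2) (g : 'I_N -> R) :
  0 < tol -> pseudo_shattered (pdhg_class T tol z0) x g ->
  (2 ^ N <= run_bound n m1 N T ^ (4 * T).+1)%N.
Proof.
move=> tol0 sh.
have := few_comp (fun b : {ffun 'I_N -> bool} => [ffun k => (T%:R < g k) || ~~ b k])
  (few_outcomes T x g z0 tol0).
have -> : (2 ^ N = #|[set: {ffun 'I_N -> bool}]%SET|)%N.
  by rewrite cardsT card_ffun card_bool card_ord.
move=> /few_card; apply => s _.
have [f [eta [omega [eta0 omega0 ->]]] fs] := sh s.
exists (eta / omega, eta * omega) => //; apply/ffunP => k; rewrite !ffunE.
have /sgr_sign_lt0 <- := fs k; rewrite subr_lt0 pdhg_steps_lt run_flag negbK.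
by congr (_ || _); apply: eq_has => t; rewrite pdhg_iter.
Qed.

Lemma not_shattered_one tol z0 N (x : 'I_N -> lp R n m1 m2) (g : 'I_N -> R) :
  pseudo_shattered (pdhg_class 1 tol z0) x g -> N = 0%N.
Proof.
case: N x g => // N x g sh.
have once eta omega :
    ((pdhg_steps (x ord0) 1 tol (z0 (x ord0)) eta omega)%:R < g ord0) =
    (1%:R < g ord0) || terminate (x ord0) tol (z0 (x ord0)) && (0%:R < g ord0).
  by rewrite pdhg_steps_lt (has_seq1 _ 0%N).
have [f [eta [omega [_ _ ->]]] /(_ ord0)/sgr_sign_lt0 E] := sh (fun=> true).
have [f' [eta' [omega' [_ _ ->]]] /(_ ord0)/sgr_sign_lt0 E'] := sh (fun=> false).
rewrite subr_lt0 once in E; rewrite subr_lt0 once in E'.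
by have : true = false by rewrite -E' E.
Qed.

End Shattering.

(** * Solving the inequality for the number of instances *)
(** Taking logarithms leaves [N <= O(T * (log N + log L))]. The term in [log N]
    is absorbed by the left-hand side, as
    [log N <= N / (w * T) + log w + log T] for every [w > 0]. *)
Lemma le_of_exp_le (R : realType) (a b : nat) : (0 < a)%N -> (0 < b)%N ->
  exists2 C : R, 0 < C &
    forall N T L : nat, (0 < N)%N -> (0 < T)%N -> (1 < L)%N -> (T <= L)%N ->
      (2 ^ N <= (a * N * L) ^ (b * T))%N -> N%:R <= C * T%:R * ln L%:R :> R.
Proof.
move=> a0 b0; pose kappa : R := ln 2.
have kappa0 : 0 < kappa by rewrite ln_gt0// ltr1n.
have b0' : 0 < b%:R :> R by rewrite ltr0n.
(* With this weight half of the left-hand side absorbs the term in log N. *)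
pose w : R := 2 * b%:R / kappa; have w0 : 0 < w by rewrite divr_gt0 ?mulr_gt0.
pose D : R := ln a%:R + ln w.
have C0 : 0 < w * (`|D| / kappa + 2).
  by rewrite mulr_gt0// ltr_wpDl// divr_ge0// ltW.
exists (w * (`|D| / kappa + 2)) => // N T L N0 T0 L1 TL le.
have T0' : 0 < T%:R :> R by rewrite ltr0n.
have a0' : 0 < a%:R :> R by rewrite ltr0n.
have L0' : 0 < L%:R :> R by rewrite ltr0n; lia.
have kL : kappa <= ln L%:R by rewrite ler_ln ?posrE// ler_nat.
have TL' : ln T%:R <= ln L%:R :> R by rewrite ler_ln ?posrE// ler_nat.
have N0' : 0 < N%:R :> R by rewrite ltr0n.
have h1 : N%:R * kappa <= (b * T)%:R * (ln a%:R + ln N%:R + ln L%:R).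
  rewrite -!lnM ?posrE ?mulr_gt0// [N%:R * kappa]mulr_natl [(b * T)%:R * _]mulr_natl.
  rewrite -!lnXn ?mulr_gt0//.
  by rewrite ler_ln ?posrE ?exprn_gt0 ?mulr_gt0// -!natrM -!natrX ler_nat.
have h2 : ln N%:R <= N%:R / (w * T%:R) + ln w + ln T%:R.
  have wT0 : 0 < w * T%:R by rewrite mulr_gt0.
  rewrite -addrA -lnM ?posrE// -lerBlDr -ln_div ?posrE//.
  apply: le_trans (ltW (ln_sublinear _)) _; first by rewrite divr_gt0.
  rewrite le_eqVlt; apply/orP; left; apply/eqP; field.
  by rewrite !gt_eqF.
have h3 : ln a%:R + ln w <= `|D| by exact: ler_norm.
have h4 : `|D| <= `|D| / kappa * ln L%:R.
  by rewrite mulrAC -mulrA ler_peMr// ler_pdivlMr// mul1r.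
rewrite natrM in h1.
have h5 : N%:R * kappa <= b%:R * T%:R *
    (ln a%:R + (N%:R / (w * T%:R) + ln w + ln T%:R) + ln L%:R).
  apply: le_trans h1 _; rewrite ler_pM2l ?mulr_gt0//.
  by rewrite lerD2r lerD2l.
have h6 : b%:R * T%:R * (N%:R / (w * T%:R)) = N%:R * kappa / 2 :> R.
  by rewrite /w; field; rewrite !gt_eqF.
have h7 : N%:R * kappa / 2 <= b%:R * T%:R * ((`|D| / kappa + 2) * ln L%:R).
  have le_log : ln a%:R + ln w + ln T%:R + ln L%:R <=
      (`|D| / kappa + 2) * ln L%:R.
    by rewrite [leRHS]mulrDl; lra.
  rewrite -(ler_pM2l (x := b%:R * T%:R)) ?mulr_gt0// in le_log.
  by move: h6 h5 le_log; rewrite !mulrDr; lra.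
rewrite -(ler_pM2r kappa0) -(ler_pM2r (x := 2^-1)) ?invr_gt0//.
apply: le_trans h7 _; rewrite le_eqVlt; apply/orP; left; apply/eqP.
by rewrite /w; field; rewrite !gt_eqF.
Qed.

(** With [mu = maxn m1 1 * maxn n 1] the constants come from
    [2 * n + m1 + 10 <= 13 * mu] and [4 * T + 2 <= 5 * T], where [13 * 5 + 1 = 66], and from the exponent
    [3 * (4 * T + 1) <= 15 * T]. *)
Lemma run_bound_le (n m1 N T : nat) : (0 < N)%N -> (1 < T)%N ->
  (run_bound n m1 N T ^ (4 * T).+1 <=
   (132 * N * (maxn m1 1 * maxn n 1 * T)) ^ (15 * T))%N.
Proof.
move=> N0 T1; set mu := (maxn m1 1 * maxn n 1)%N.
have mu_ge : (2 * n + m1 + 10 <= 13 * mu)%N by rewrite /mu; nia.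
have mu1 : (0 < mu)%N by rewrite /mu; nia.
clearbody mu.
rewrite /run_bound /branch_bound; set s := (N * _ * _).+1.
have s_le : (s <= 66 * (N * (mu * T)))%N.
  have NT : (0 < N * (mu * T))%N by rewrite !muln_gt0 N0 mu1; lia.
  have -> : s = (N * ((2 * n + m1 + 10) * (4 * T).+2)).+1 by rewrite /s mulnA.
  have : ((2 * n + m1 + 10) * (4 * T).+2 <= 65 * (mu * T))%N.
    have : ((2 * n + m1 + 10) * (4 * T).+2 <= 13 * mu * (5 * T))%N.
      by apply: leq_mul => //; lia.
    by nia.
  by move=> /(leq_mul (leqnn N)); nia.
have -> : (132 * N * (mu * T) = 2 * (66 * (N * (mu * T))))%N by lia.
apply: (@leq_trans ((2 * s) ^ (15 * T))); last by rewrite leq_exp2r ?leq_mul2l//; lia.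
apply: (@leq_trans (((2 * s) ^ 3) ^ (4 * T).+1)).
  by rewrite leq_exp2r// expnMn leq_mul2r; apply/orP; right.
by rewrite -expnM leq_pexp2l//; lia.
Qed.

Theorem theorem3p3 (R : realType) :
  exists2 C : R, 0 < C &
  forall (n m1 m2 T : nat) (tol : R)
    (z0 : lp R n m1 m2 -> 'cV[R]_n * 'cV[R]_(m1 + m2)),
    (1 <= T)%N -> 0 < tol ->
    (Pdim (pdhg_class T tol z0)
      <= (C * T%:R * ln ((maxn m1 1 * maxn n 1 * T)%N%:R))%:E)%E.
Proof.
have [C C0 HC] := @le_of_exp_le R 132 15 isT isT.
exists C => // n m1 m2 T tol z0 T1 tol0.
set L := (maxn m1 1 * maxn n 1 * T)%N.
have TL : (T <= L)%N by rewrite /L leq_pmull// muln_gt0 !leq_max !orbT.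
apply: ge_ereal_sup => _ [N [x [g sh]] <-]; rewrite lee_fin.
have [->|N0] := posnP N.
  by rewrite !mulr_ge0 ?(ltW C0)// ln_ge0// ler1n (leq_trans T1).
have [T2|T2] := leqP T 1.
  have T_eq : T = 1%N by apply/eqP; rewrite eqn_leq T2.
  by move: N0; rewrite {}T_eq in sh *; rewrite (not_shattered_one sh).
apply: HC => //; first exact: leq_trans T2 TL.
apply: leq_trans (shattered_exp_le tol0 sh) _.
exact: run_bound_le.
Qed.
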